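(* Let $G\in C^7(\mathbb{R})$ with $G''>0$ and $g:=G-G'\cdot\mathrm{Id}>0$, $g$ not constant. Let $\Sigma=F(M)\subset\mathbb{R}^2$ be the $C^5$-immersed closed reference curve described in the context (a doubly covered circular arc of radius $R>0$ whose two strands are split smoothly and connected at each end of the arc), with unit normal $\nu_\Sigma$ and with points $z_l\ne z_r$ in $M$ satisfying $$F(z_l)=F(z_r)=(0,0),\qquad \nu_\Sigma(z_l)=(-1,0),\qquad \nu_\Sigma(z_r)=(1,0).$$ Let $\rho_0>0$ be a constant and let $u_0\in C^4(M)$ satisfy $g(u_0(z_l))>g(u_0(z_r))$. Then for all sufficiently small $\varepsilon>0$ the initial curve $$\Gamma_0^\varepsilon=\big\{F(z)+\varepsilon\rho_0\,\nu_\Sigma(z)\ :\ z\in M\big\}$$ is an embedded curve whose evolution under $$V=g(c)H,\qquad \partial^\square c=\Delta_\Gamma\big(G'(c)\big)+cHV$$ with initial concentration $u_0$ leads to a self-intersection; that is, $z\mapsto F(z)+\varepsilon\rho_0\nu_\Sigma(z)$ is an embedding of $M$, but there is a time $t>0$ in the existence interval of the evolution at which the parameterization $\theta_{\rho^\varepsilon}(t,\cdot):M\to\mathbb{R}^2$ of the evolving curve is not injective.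
   Context: Reference curve. $M\subset\mathbb{R}^2$ is a $C^5$-embedded closed (compact, connected) curve and $F:M\to\mathbb{R}^2$ is a $C^5$-immersion with image $\Sigma$ of the following shape. Let $\mathcal{A}$ be a proper closed arc of the circle of radius $R$ centred at $(R,0)$, containing $(0,0)$ in its relative interior (e.g. the left half circle). $M$ is the union of four consecutive arcs $I_l,J_+,I_r,J_-$ meeting only in endpoints. $F$ maps each of $I_l$ and $I_r$ bijectively onto $\mathcal{A}$. $F$ maps the interiors of $J_+$ and $J_-$ injectively onto two curves disjoint from each other and from $\mathcal{A}$; each closes up, at one of the two endpoints of $\mathcal{A}$, to a simple closed loop. Near that endpoint, the two strands of the loop are normal graphs over the continuation of the circle beyond the endpoint, the strand continuing $I_l$ lying strictly farther from the centre $(R,0)$ than the strand continuing $I_r$, and the thin region between these strands belongs to the bounded region enclosed by the loop. (A smooth splitting is obtained, e.g., after translation, by continuing the arc $y=\sqrt{R^2-x^2}$ by $y_{1,2}=\sqrt{R^2-x^2}\pm\exp(-1/x)$, $x>0$.) Thus $\Sigma$ is a degenerate ''tube'' of zero thickness along $\mathcal{A}$. The continuous unit normal $\nu_\Sigma:M\to\mathbb{R}^2$ is chosen to point away from the centre $(R,0)$ on $I_l$ and towards the centre on $I_r$ (hence out of the enclosed regions on $J_\pm$). $z_l\in I_l$ and $z_r\in I_r$ are the two preimages of $(0,0)$. Geometry. For an evolving immersed curve $\Gamma(t)=\theta(t,M)$ with global parameterization $\theta:[0,T]\times M\to\mathbb{R}^2$ and unit normal $\nu$, functions on $\Gamma(t)$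 are identified with functions on $[0,T]\times M$; $H:=-\mathrm{div}_\Gamma\nu$ is the (mean) curvature, $V^{\mathrm{tot}}:=\partial_t\theta$, $V:=V^{\mathrm{tot}}\cdot\nu$, $\nabla_\Gamma,\Delta_\Gamma$ are the surface gradient and Laplace-Beltrami operator, and $\partial^\square f:=\partial_tf-V^{\mathrm{tot}}\cdot\nabla_\Gamma f$. Meaning of ''evolution''. For a height function $\rho:[0,T]\times M\to\mathbb{R}$, small in $C^0$, put $\theta_\rho(t,z):=F(z)+\rho(t,z)\nu_\Sigma(z)$, $\Gamma_\rho(t):=\theta_\rho(t,M)$ (an evolving immersed closed curve), $H(\rho):=H_{\Gamma_\rho}$ and $a(\rho):=1/(\nu_\Sigma\cdot\nu_{\Gamma_\rho})$. A known short-time existence theorem states: for a $C^5$-immersed closed $\Sigma$, $u_0\in C^4(M)$, $G\in C^7(\mathbb{R})$ with $G''>0$ and $g:=G-G'\cdot\mathrm{Id}>0$, and any $\delta_1>0$, there are $\delta_0,T,R^h>0$ depending only on $(\Sigma,u_0,\delta_1)$ such that for every $\tilde\rho_0\in C^4(M)$ with $\|\tilde\rho_0\|_{C^4(M)}<\delta_1$ and $\|\tilde\rho_0\|_{C^2(M)}<\delta_0$ there exist $\rho,u\in C^1([0,T],C^0(M))\cap C^0([0,T],C^2(M))$ solving $$\partial_t\rho=g(u)a(\rho)H(\rho),\qquad \partial_tu=\Delta_{\Gamma_\rho}G'(u)+g(u)a(\rho)H(\rho)\,\nu_\Sigma\cdot\nabla_{\Gamma_\rho}u+g(u)H(\rho)^2u$$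 on $[0,T]\times M$ with $\rho(0)=\tilde\rho_0$, $u(0)=u_0$, and satisfying $\|\partial_t\rho(t)-\partial_t\rho(0)\|_{C^0(M)}+\|\rho(t)-\rho(0)\|_{C^2(M)}\le R^hT^{1/4}$ and the same estimate for $u$ for all $t\in[0,T]$ (also with $T$ replaced by any smaller positive final time); any two solutions coincide on some $[0,\overline T]$, $\overline T\in(0,T]$. The evolution of $\Gamma_0^\varepsilon$ is the evolving immersed curve $\Gamma_{\rho^\varepsilon}$ with parameterization $\theta_{\rho^\varepsilon}$, together with the concentration $c=u^\varepsilon$, where $(\rho^\varepsilon,u^\varepsilon)$ on $[0,T]$ is the solution provided by this theorem for $\tilde\rho_0=\varepsilon\rho_0$ (existence time $T$ independent of small $\varepsilon$); it solves the system $V=g(c)H$, $\partial^\square c=\Delta_\Gamma\big(G'(c)\big)+cHV$. *)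

(* Defs.v *)
From Stdlib Require Import Reals ZArith Lra.
From Coquelicot Require Export Coquelicot.
Open Scope R_scope.

(** * Plane vectors and curves [R -> R * R] *)

Definition dot (v w : R * R) : R := fst v * fst w + snd v * snd w.
Definition vnorm (v : R * R) : R := sqrt (dot v v).
Definition rot (v : R * R) : R * R := (- snd v, fst v).
Definition vfst (p : R -> R * R) (s : R) : R := fst (p s).
Definition vsnd (p : R -> R * R) (s : R) : R := snd (p s).
Definition dvec (p : R -> R * R) (s : R) : R * R :=
  (Derive (vfst p) s, Derive (vsnd p) s).

Definition Ck (k : nat) (f : R -> R) : Prop :=
  (forall (j : nat) (x : R), (j <= k)%nat -> ex_derive_n f j x) /\
  (forall x : R, continuous (Derive_n f k) x).
Definition vCk (k : nat) (p : R -> R * R) : Prop := Ck k (vfst p) /\ Ck k (vsnd p).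

(** * The closed curve M

    A C^5-embedded closed curve in the plane is given with a periodic
    arc-length parameterization; [M] is its range.  Functions on [M] are
    functions on the plane whose values off [M] are irrelevant, and they are
    differentiated along [M] through [fun s => f (gam M s)]. *)

Record closed_curve : Type := ClosedCurve {
  gam : R -> R * R;
  len : R;
  len_pos : 0 < len;
  gam_C5 : vCk 5 gam;
  gam_unit_speed : forall s : R, dot (dvec gam s) (dvec gam s) = 1;
  gam_period : forall s r : R,
    gam s = gam r <-> exists k : Z, r = s + IZR k * len }.

Definition on_curve (M : closed_curve) (z : R * R) : Prop := exists s : R, z = gam M s.
Definition closed_arc (M : closed_curve) (a b : R) (z : R * R) : Prop :=
  exists s : R, a <= s <= b /\ z = gam M s.
Definition open_arc (M : closed_curve) (a b : R) (z : R * R) : Prop :=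
  exists s : R, a < s < b /\ z = gam M s.

Definition along {A : Type} (M : closed_curve) (f : R * R -> A) : R -> A :=
  fun s => f (gam M s).

Definition CkM (M : closed_curve) (k : nat) (f : R * R -> R) : Prop := Ck k (along M f).

Definition sup_abs (f : R -> R) : R :=
  real (Lub_Rbar (fun y => exists s : R, y = Rabs (f s))).

(* [gam M] has unit speed, so [Derive_n (along M f) j] is the j-th arc-length
   derivative of [f]; [sum_f_R0 _ k] has the k + 1 terms j = 0, ..., k. *)
Definition CkM_norm (M : closed_curve) (k : nat) (f : R * R -> R) : R :=
  sum_f_R0 (fun j => sup_abs (Derive_n (along M f) j)) k.

Definition inj_on (Th : R * R -> R * R) (A : R * R -> Prop) : Prop :=
  forall z w : R * R, A z -> A w -> Th z = Th w -> z = w.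

Definition maps_bijectively (Th : R * R -> R * R) (A B : R * R -> Prop) : Prop :=
  (forall z, A z -> B (Th z)) /\ (forall p, B p -> exists! z, A z /\ Th z = p).

(* Injective C^1 immersion that is a homeomorphism onto its image. *)
Definition is_embedding (M : closed_curve) (Th : R * R -> R * R) : Prop :=
  vCk 1 (along M Th) /\
  (forall s : R, dvec (along M Th) s <> (0, 0)) /\
  inj_on Th (on_curve M) /\
  (forall z, on_curve M z -> forall e : R, 0 < e -> exists d : R, 0 < d /\
     forall w, on_curve M w ->
       vnorm (minus (Th w) (Th z)) < d -> vnorm (minus w z) < e).

(** * The reference curve *)

(* Polar coordinates around (Rad, 0), the angle being measured from (0, 0). *)
Definition polar_pt (Rad phi r : R) : R * R := (Rad - r * cos phi, r * sin phi).

Definition circle_arc (Rad em ep : R) (p : R * R) : Prop :=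
  exists phi : R, em <= phi <= ep /\ p = polar_pt Rad phi Rad.

(* [p] lies in a bounded component of the complement of [K]. *)
Definition enclosed (K : R * R -> Prop) (p : R * R) : Prop :=
  ~ K p /\
  exists B : R, forall c : R -> R * R,
    (forall s : R, continuous c s) -> c 0 = p ->
    (forall s : R, 0 <= s <= 1 -> ~ K (c s)) -> vnorm (c 1) <= B.

(* The strand [p] over the parameters (0, eta) is the normal graph of [h] over
   the part of the circle at angular distance in (0, delta) beyond the endpoint
   of angle [e]; the sign [d] is the direction of increasing distance. *)
Definition normal_graph (Rad e d : R) (p : R -> R * R) (eta delta : R)
    (h : R -> R) : Prop :=
  (forall tau, 0 < tau < eta -> exists phi, 0 < phi < delta /\
     p tau = polar_pt Rad (e + d * phi) (Rad + h phi)) /\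
  (forall phi, 0 < phi < delta -> exists tau, 0 < tau < eta /\
     p tau = polar_pt Rad (e + d * phi) (Rad + h phi)).

(* [pl] and [pr] are the strands of [loop] that continue I_l and I_r, both
   parameterized so that they leave the endpoint at parameter 0. *)
Definition splits_at (Rad e d : R) (pl pr : R -> R * R) (loop : R * R -> Prop) : Prop :=
  exists (delta etal etar : R) (hl hr : R -> R),
    0 < delta < PI /\ 0 < etal /\ 0 < etar /\
    normal_graph Rad e d pl etal delta hl /\
    normal_graph Rad e d pr etar delta hr /\
    forall phi, 0 < phi < delta ->
      - Rad < hr phi < hl phi /\
      forall h, hr phi < h < hl phi ->
        enclosed loop (polar_pt Rad (e + d * phi) (Rad + h)).

Definition image (Th : R * R -> R * R) (A : R * R -> Prop) (p : R * R) : Prop :=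
  exists z, A z /\ p = Th z.

(* I_l, J_+, I_r, J_- are the images under [gam M] of [b0, b1], [b1, b2],
   [b2, b3], [b3, b0 + len M].  J_+ names the loop at the endpoint of positive
   angle; since M may be traversed in either direction this is no restriction. *)
Record reference_curve (M : closed_curve) (F nu : R * R -> R * R) (Rad : R) : Type :=
  ReferenceCurve {
  b0 : R; b1 : R; b2 : R; b3 : R;
  em : R; ep : R;
  Rad_pos : 0 < Rad;
  b_order : b0 < b1 /\ b1 < b2 /\ b2 < b3 /\ b3 < b0 + len M;
  arc_contains_origin : em < 0 < ep;
  arc_proper : ep - em < 2 * PI;
  F_C5 : vCk 5 (along M F);
  F_immersion : forall s, dvec (along M F) s <> (0, 0);
  Il_arc : maps_bijectively F (closed_arc M b0 b1) (circle_arc Rad em ep);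
  Ir_arc : maps_bijectively F (closed_arc M b2 b3) (circle_arc Rad em ep);
  Jp_inj : inj_on F (open_arc M b1 b2);
  Jm_inj : inj_on F (open_arc M b3 (b0 + len M));
  Jp_Jm_disjoint : forall z w, open_arc M b1 b2 z ->
    open_arc M b3 (b0 + len M) w -> F z <> F w;
  Jp_arc_disjoint : forall z, open_arc M b1 b2 z -> ~ circle_arc Rad em ep (F z);
  Jm_arc_disjoint : forall z, open_arc M b3 (b0 + len M) z ->
    ~ circle_arc Rad em ep (F z);
  Jp_closes : F (gam M b1) = polar_pt Rad ep Rad /\
              F (gam M b2) = polar_pt Rad ep Rad;
  Jm_closes : F (gam M b3) = polar_pt Rad em Rad /\
              F (gam M (b0 + len M)) = polar_pt Rad em Rad;
  Jp_splits : splits_at Rad ep 1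
    (fun tau => F (gam M (b1 + tau))) (fun tau => F (gam M (b2 - tau)))
    (image F (closed_arc M b1 b2));
  Jm_splits : splits_at Rad em (-1)
    (fun tau => F (gam M (b0 + len M - tau))) (fun tau => F (gam M (b3 + tau)))
    (image F (closed_arc M b3 (b0 + len M)));
  nu_continuous : forall s, continuous (along M nu) s;
  nu_unit : forall s, dot (along M nu s) (along M nu s) = 1;
  nu_normal : forall s, dot (along M nu s) (dvec (along M F) s) = 0;
  nu_away_on_Il : forall z, closed_arc M b0 b1 z ->
    0 < dot (nu z) (minus (F z) (Rad, 0));
  nu_towards_on_Ir : forall z, closed_arc M b2 b3 z ->
    dot (nu z) (minus (F z) (Rad, 0)) < 0 }.

Definition I_l {M F nu Rad} (S : reference_curve M F nu Rad) : R * R -> Prop :=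
  closed_arc M (b0 _ _ _ _ S) (b1 _ _ _ _ S).
Definition I_r {M F nu Rad} (S : reference_curve M F nu Rad) : R * R -> Prop :=
  closed_arc M (b2 _ _ _ _ S) (b3 _ _ _ _ S).

(** * Geometry of a regular curve in terms of a parameterization [p] *)

Definition utangent (p : R -> R * R) (s : R) : R * R :=
  scal (/ vnorm (dvec p s)) (dvec p s).
Definition sgrad (p : R -> R * R) (f : R -> R) (s : R) : R * R :=
  scal (Derive f s / dot (dvec p s) (dvec p s)) (dvec p s).
Definition sdiv (p w : R -> R * R) (s : R) : R :=
  dot (dvec w s) (dvec p s) / dot (dvec p s) (dvec p s).
Definition laplace_beltrami (p : R -> R * R) (f : R -> R) : R -> R :=
  sdiv p (sgrad p f).

(** * Curves described by a height function over the reference curve *)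

Definition theta (F nu : R * R -> R * R) (rho : R * R -> R) (z : R * R) : R * R :=
  plus (F z) (scal (rho z) (nu z)).

(* The reference normal is [+rot] or [-rot] of the unit tangent of F; the first
   factor is that sign, so [nu_G] is the unit normal of Gamma_rho on the same
   side as [nu]. *)
Definition nu_G (M : closed_curve) (F nu : R * R -> R * R) (rho : R * R -> R)
    (s : R) : R * R :=
  scal (dot (along M nu s) (rot (utangent (along M F) s)))
       (rot (utangent (along M (theta F nu rho)) s)).

Definition curvature M F nu rho (s : R) : R :=
  - sdiv (along M (theta F nu rho)) (nu_G M F nu rho) s.

Definition a_factor M F nu rho (s : R) : R :=
  / dot (along M nu s) (nu_G M F nu rho s).

(* Holds for every C^1 function [rho] that is small in C^0, and makes H and a
   meaningful. *)
Definition immersed_graph M F nu rho : Prop :=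
  forall s, dvec (along M (theta F nu rho)) s <> (0, 0) /\
            0 < dot (along M nu s) (nu_G M F nu rho s).

(** * Time-dependent functions on [0,T] x M *)

(* Time derivative relative to [0,T], hence one-sided at 0 and T. *)
Definition is_dt (T : R) (f : R -> R) (t l : R) : Prop :=
  filterlim (fun r => (f r - f t) / (r - t))
    (within (fun r => 0 <= r <= T) (locally' t)) (locally l).
Definition dt (T : R) (f : R -> R) (t : R) : R := iota (is_dt T f t).
Definition dtM (T : R) (f : R -> R * R -> R) (t : R) (z : R * R) : R :=
  dt T (fun r => f r z) t.

Definition C0_in_time (M : closed_curve) (T : R) (k : nat) (f : R -> R * R -> R) : Prop :=
  (forall t, 0 <= t <= T -> CkM M k (f t)) /\
  (forall t, 0 <= t <= T -> forall e, 0 < e -> exists d, 0 < d /\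
     forall r, 0 <= r <= T -> Rabs (r - t) < d ->
       CkM_norm M k (fun z => f r z - f t z) < e).

Definition C1_in_time (M : closed_curve) (T : R) (k : nat) (f : R -> R * R -> R) : Prop :=
  C0_in_time M T k f /\ C0_in_time M T k (dtM T f) /\
  (forall t, 0 <= t <= T -> forall e, 0 < e -> exists d, 0 < d /\
     forall r, 0 <= r <= T -> r <> t -> Rabs (r - t) < d ->
       CkM_norm M k (fun z => (f r z - f t z) / (r - t) - dtM T f t z) < e).

Definition holder_estimate (M : closed_curve) (T Rh : R) (f : R -> R * R -> R) : Prop :=
  forall tau, 0 < tau <= T -> forall t, 0 <= t <= tau ->
    CkM_norm M 0 (fun z => dtM T f t z - dtM T f 0 z)
    + CkM_norm M 2 (fun z => f t z - f 0 z) <= Rh * Rpower tau (1 / 4).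

(** * The evolution *)

Definition g_of (G : R -> R) (x : R) : R := G x - Derive G x * x.

Definition is_solution (G : R -> R) (M : closed_curve) (F nu : R * R -> R * R)
    (u0 rho0 : R * R -> R) (T : R) (rho u : R -> R * R -> R) : Prop :=
  C1_in_time M T 0 rho /\ C0_in_time M T 2 rho /\
  C1_in_time M T 0 u /\ C0_in_time M T 2 u /\
  (forall z, on_curve M z -> rho 0 z = rho0 z /\ u 0 z = u0 z) /\
  (forall t, 0 <= t <= T -> immersed_graph M F nu (rho t)) /\
  (forall t s, 0 <= t <= T ->
    let p := along M (theta F nu (rho t)) in
    let c := along M (u t) in
    let H := curvature M F nu (rho t) s in
    let a := a_factor M F nu (rho t) s in
    dtM T rho t (gam M s) = g_of G (c s) * a * H /\
    dtM T u t (gam M s) =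
      laplace_beltrami p (fun x => Derive G (c x)) s
      + g_of G (c s) * a * H * dot (along M nu s) (sgrad p c s)
      + g_of G (c s) * H ^ 2 * c s).

Definition is_evolution G M F nu u0 rho0 (T Rh : R) rho u : Prop :=
  is_solution G M F nu u0 rho0 T rho u /\
  holder_estimate M T Rh rho /\ holder_estimate M T Rh u.

(* [delta0], [T] and [Rh] are constants as in the short-time existence theorem
   for the reference curve, the initial concentration [u0] and [delta1]. *)
Definition short_time_existence G M F nu u0 (delta1 delta0 T Rh : R) : Prop :=
  0 < delta0 /\ 0 < T /\ 0 < Rh /\
  forall rho0 : R * R -> R,
    CkM M 4 rho0 -> CkM_norm M 4 rho0 < delta1 -> CkM_norm M 2 rho0 < delta0 ->
    (exists rho u, is_evolution G M F nu u0 rho0 T Rh rho u) /\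
    (forall rho u rho' u',
       is_solution G M F nu u0 rho0 T rho u ->
       is_solution G M F nu u0 rho0 T rho' u' ->
       exists Tbar, 0 < Tbar <= T /\
         forall t z, 0 <= t <= Tbar -> on_curve M z ->
           rho t z = rho' t z /\ u t z = u' t z).

(* V = g(c) H and d^square c = Delta_Gamma (G'(c)) + c H V, for the evolving
   curve parameterized by theta_rho. *)
Definition solves_geometric_system G M F nu (T : R) (rho c : R -> R * R -> R) : Prop :=
  forall t s, 0 <= t <= T ->
    let p := along M (theta F nu (rho t)) in
    let H := curvature M F nu (rho t) s in
    let Vtot : R * R :=
      (dt T (fun r => fst (theta F nu (rho r) (gam M s))) t,
       dt T (fun r => snd (theta F nu (rho r) (gam M s))) t) in
    let V := dot Vtot (nu_G M F nu (rho t) s) in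
    V = g_of G (c t (gam M s)) * H /\
    dtM T c t (gam M s) - dot Vtot (sgrad p (along M (c t)) s) =
      laplace_beltrami p (fun x => Derive G (c t (gam M x))) s
      + c t (gam M s) * H * V.

(* Main.v *)
Require Import Defs.
From Stdlib Require Import Reals Lra Lia Psatz ClassicalEpsilon FunctionalExtensionality.
Open Scope R_scope.

(** Along the doubly covered arc the offset by [e = eps * rho0] moves the
    strand I_l to the circle of radius [Rad + e] and I_r to the circle of
    radius [Rad - e] : the tube of zero thickness opens to one of width [2 * e],
    and then both strands move towards the centre, with speeds close to
    g(c) / Rad whatever the width is. The outer strand is the faster one near the
    origin, so it catches up with the inner one after a time of order [e].

    Embeddedness. By compactness of M x M it suffices to understand the offset
    curves near each pair of parameters (s, r) for small [e]
    ([uniform_on_square]). If F separates the two points, so do small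
    perturbations of F; if they are the same point of M, the immersion is
    injective nearby, uniformly in [e]. The remaining pairs are the double
    points, one strand being part of I_l or of a loop continuing it, the other
    one of I_r or of its continuation, both tangent to the circle. Compare
    distances to the centre of the circle along a common ray: a point of the
    offset outer strand lies strictly farther out than the point of the outer
    strand on the same ray, because a C^1 strand almost tangent to the circle
    moves radially by much less than [e] while it turns by an angle of order [e]
    ([offset_on_ray]); symmetrically a point of the offset inner strand lies
    strictly closer than the inner strand. On every ray the inner strand is at
    most as far as the outer one: they agree over the arc and the splitting
    orders them beyond its endpoints ([radial_order_at_end]). So the two offset
    strands are disjoint ([offsets_disjoint]).

    Self-intersection. At time 0 the curve is a circle near z_l and near z_r, of
    curvature [- 1 / (Rad + e)] and [1 / (Rad - e)] with respect to its normal,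
    and the factor a equals 1 there. Hence the width
    [rho t zl + rho t zr] of the tube on the horizontal axis starts from [2 * e]
    with time derivative close to [- (gl - gr) / Rad < 0], where gl and gr are the
    initial values of g(c) at the two points. The Hoelder estimate keeps
    the derivative below a negative constant up to a time [tau] that does not
    depend on [e]; once [e] is small compared with [tau], the width vanishes at
    some positive time ([crossing_time]), and at that time z_l and z_r have the
    same image. *)

(** * Continuity, compactness and mean values *)

Lemma continuous_Rplus {U : UniformSpace} (f g : U -> R) (x : U) :
  continuous f x -> continuous g x -> continuous (fun y => f y + g y) x.
Proof. intros; now apply (continuous_plus f g). Qed.

Lemma continuous_Rminus {U : UniformSpace} (f g : U -> R) (x : U) :
  continuous f x -> continuous g x -> continuous (fun y => f y - g y) x.
Proof. intros; now apply (continuous_minus f g). Qed.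

Lemma continuous_Ropp {U : UniformSpace} (f : U -> R) (x : U) :
  continuous f x -> continuous (fun y => - f y) x.
Proof. intros; now apply (continuous_opp f). Qed.

Lemma continuous_Rmult {U : UniformSpace} (f g : U -> R) (x : U) :
  continuous f x -> continuous g x -> continuous (fun y => f y * g y) x.
Proof. intros; now apply (continuous_mult f g). Qed.

Lemma continuous_1st (g : R -> R) (a b c : R) :
  continuous g a -> continuous (fun x : R * R * R => g (fst (fst x))) (a, b, c).
Proof.
intros Hg; apply (continuous_comp (fun x : R * R * R => fst (fst x)) g); [|exact Hg].
apply (continuous_comp (fun x : R * R * R => fst x) fst); apply continuous_fst.
Qed.

Lemma continuous_2nd (g : R -> R) (a b c : R) :
  continuous g b -> continuous (fun x : R * R * R => g (snd (fst x))) (a, b, c).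
Proof.
intros Hg; apply (continuous_comp (fun x : R * R * R => snd (fst x)) g); [|exact Hg].
apply (continuous_comp (fun x : R * R * R => fst x) snd);
  [apply continuous_fst|apply continuous_snd].
Qed.

Lemma continuous_3rd (a b c : R) :
  continuous (fun x : R * R * R => snd x) (a, b, c).
Proof. apply continuous_snd. Qed.

Ltac continuity_3 := cbv beta;
  repeat match goal with
  | |- continuous (fun _ => ?k) _ => apply continuous_const
  | |- continuous (fun x => _ + _) _ => apply continuous_Rplus
  | |- continuous (fun x => _ - _) _ => apply continuous_Rminus
  | |- continuous (fun x => - _) _ => apply continuous_Ropp
  | |- continuous (fun x => _ * _) _ => apply continuous_Rmult
  | |- continuous snd (_, _, _) => apply continuous_3rd
  | |- continuous (fun x => snd x) (_, _, _) => apply continuous_3rd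
  | |- continuous (fun x => ?g (fst (fst x))) (_, _, _) => apply (continuous_1st g)
  | |- continuous (fun x => ?g (snd (fst x))) (_, _, _) => apply (continuous_2nd g)
  end; try assumption.

(** A strict inequality between continuous expressions in two curve parameters and
    the offset distance persists nearby; all local estimates below are obtained
    in this form. *)
Lemma positive_nearby (f : R -> R -> R -> R) (a b c : R) :
  continuous (fun x : R * R * R => f (fst (fst x)) (snd (fst x)) (snd x)) (a, b, c) ->
  0 < f a b c ->
  exists d, 0 < d /\ forall x y z,
    Rabs (x - a) < d -> Rabs (y - b) < d -> Rabs (z - c) < d -> 0 < f x y z.
Proof.
intros Hc Hp.
destruct (Hc (fun v => 0 < v)) as [d Hd].
{ exists (mkposreal _ Hp); intros y Hy; apply Rabs_def2 in Hy.
  unfold minus, plus, opp in Hy; simpl in Hy; lra. }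
exists d; split; [apply cond_pos|].
intros x y z Hx Hy Hz; apply (Hd ((x, y), z)); repeat split; assumption.
Qed.

Lemma positive_nearby_1 (f : R -> R) (a : R) :
  continuous f a -> 0 < f a ->
  exists d, 0 < d /\ forall x, Rabs (x - a) < d -> 0 < f x.
Proof.
intros Hf Ha.
destruct (positive_nearby (fun x _ _ => f x) a 0 0) as (d & Hd & H); [continuity_3|exact Ha|].
exists d; split; [exact Hd|]; intros x Hx; apply (H x 0 0); trivial;
  rewrite Rminus_0_r, Rabs_R0; exact Hd.
Qed.

(** Compactness of the square turns pointwise thresholds for the small parameter
    [e] into a common one. *)
Lemma uniform_on_square (a b : R) (Q : R -> R -> R -> Prop) :
  (forall x y, a <= x <= b -> a <= y <= b ->
     exists d, 0 < d /\ forall x' y' e,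
       Rabs (x' - x) < d -> Rabs (y' - y) < d -> 0 < e < d -> Q x' y' e) ->
  exists d, 0 < d /\ forall x y e, a <= x <= b -> a <= y <= b -> 0 < e < d -> Q x y e.
Proof.
intros Hloc.
assert (Hch : forall x y, exists d : posreal, a <= x <= b -> a <= y <= b ->
    forall x' y' e, Rabs (x' - x) < d -> Rabs (y' - y) < d -> 0 < e < d -> Q x' y' e).
{ intros x y.
  destruct (classic ((a <= x <= b) /\ (a <= y <= b))) as [[Hx Hy]|Hn].
  - destruct (Hloc x y Hx Hy) as (d & Hd & H).
    exists (mkposreal d Hd); intros _ _; exact H.
  - exists (mkposreal 1 Rlt_0_1); intros Hx Hy; tauto. }
pose (dl := fun x y => proj1_sig (constructive_indefinite_description _ (Hch x y))).
destruct (compactness_value_2d a b a b dl) as [d Hd].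
exists d; split; [apply cond_pos|].
intros x y e Hx Hy He.
apply NNPP; intros HQ; apply (Hd x y Hx Hy); intros (i & j & Hi & Hj & Hxi & Hyj & Hdl).
apply HQ; unfold dl in *.
destruct (constructive_indefinite_description _ (Hch i j)) as [d' Hd']; simpl in *.
apply (Hd' Hi Hj); trivial; lra.
Qed.

Lemma mean_value (f : R -> R) (a b : R) :
  (forall x, ex_derive f x) ->
  exists c, Rmin a b <= c <= Rmax a b /\ f b - f a = Derive f c * (b - a).
Proof.
intros Hf; apply MVT_gen.
- intros; now apply Derive_correct.
- intros; apply continuity_pt_filterlim, (ex_derive_continuous f); auto.
Qed.

(** * Offsets of a strand tangent to a circle *)

(** A C^1 curve [p] that starts tangentially to the circle of radius [Rad] around
    the origin, at the point in direction [c], with a unit normal field [n]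
    that is outward ([sig = 1]) or inward ([sig = -1]) at the start. *)
Record strand (Rad sig : R) (c : R * R) (p n : R -> R * R) : Prop := Strand {
  strand_diff : forall x, ex_derive (vfst p) x /\ ex_derive (vsnd p) x;
  strand_C1 : continuous (Derive (vfst p)) 0 /\ continuous (Derive (vsnd p)) 0;
  strand_normal_cont : continuous (vfst n) 0 /\ continuous (vsnd n) 0;
  strand_normal_unit : forall x, dot (n x) (n x) = 1;
  strand_start : p 0 = (Rad * fst c, Rad * snd c);
  strand_normal_start : n 0 = (sig * fst c, sig * snd c);
  strand_tangent : dot c (dvec p 0) = 0;
  strand_regular : dvec p 0 <> (0, 0) }.

(** Write w for the offset point [p t + e n t]. As the strand is transverse to the
    rays from the centre, the ray through w meets it at a parameter [x] with
    [|x - t| <= A e] ; as its tangents are almost orthogonal to the normals,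
    [p x] and [p t] differ in direction [n t] by at most [e / 2], so that w and
    [p x] are ordered along the ray like w and [p t] along the normal. *)
Lemma offset_on_ray (Rad sig : R) (c : R * R) (p n : R -> R * R) (D : R) :
  0 < Rad -> sig * sig = 1 -> strand Rad sig c p n -> 0 < D ->
  exists d, 0 < d /\ forall t e, Rabs t < d -> 0 < e < d ->
    exists x al, Rabs x < D /\ 0 < al /\ 0 < sig * (1 - al) /\
      p x = (al * (vfst p t + e * vfst n t), al * (vsnd p t + e * vsnd n t)).
Proof.
intros HR Hs [Hd [C1 C2] [N1 N2] Hu H0 Hn0 Ht Hreg] HD.
assert (U0 := Hu 0); rewrite Hn0 in U0; unfold dot in U0; simpl in U0.
assert (Hc : fst c * fst c + snd c * snd c = 1) by nra.
assert (P1 : continuous (vfst p) 0) by (apply (ex_derive_continuous (vfst p)), Hd).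
assert (P2 : continuous (vsnd p) 0) by (apply (ex_derive_continuous (vsnd p)), Hd).
assert (E1 : vfst p 0 = Rad * fst c) by (unfold vfst; now rewrite H0).
assert (E2 : vsnd p 0 = Rad * snd c) by (unfold vsnd; now rewrite H0).
assert (F1 : vfst n 0 = sig * fst c) by (unfold vfst; now rewrite Hn0).
assert (F2 : vsnd n 0 = sig * snd c) by (unfold vsnd; now rewrite Hn0).
assert (Hu' : forall x, vfst n x * vfst n x + vsnd n x * vsnd n x = 1) by exact Hu.
assert (Hp : forall x, p x = (vfst p x, vsnd p x))
  by (intros x; unfold vfst, vsnd; now destruct (p x)).
unfold dvec, dot in Ht, Hreg; simpl in Ht.
clear H0 Hn0 Hu U0; revert Hp Hd C1 C2 N1 N2 P1 P2 E1 E2 F1 F2 Hu' Ht Hreg.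
generalize (vfst p), (vsnd p), (vfst n), (vsnd n); intros p1 p2 n1 n2 Hp; intros.
set (k := fst c * Derive p2 0 - snd c * Derive p1 0).
set (K := Rad * k).
assert (Hk : k <> 0).
{ intros Hk; apply Hreg; unfold k in Hk.
  assert (Derive p1 0 = 0) by
   (transitivity (fst c * (fst c * Derive p1 0 + snd c * Derive p2 0)
      - snd c * (fst c * Derive p2 0 - snd c * Derive p1 0)
      + (1 - (fst c * fst c + snd c * snd c)) * Derive p1 0);
     [ring | rewrite Ht, Hk, Hc; ring]).
  assert (Derive p2 0 = 0) by
   (transitivity (snd c * (fst c * Derive p1 0 + snd c * Derive p2 0)
      + fst c * (fst c * Derive p2 0 - snd c * Derive p1 0)
      + (1 - (fst c * fst c + snd c * snd c)) * Derive p2 0);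
     [ring | rewrite Ht, Hk, Hc; ring]).
  congruence. }
assert (HK : K <> 0) by (unfold K; intros Z; apply Rmult_integral in Z; lra).
assert (HKa : 0 < Rabs K) by now apply Rabs_pos_lt.
assert (HKK : K * K = Rabs K * Rabs K)
  by (rewrite <- Rabs_mult, Rabs_pos_eq; [reflexivity|nra]).
(* psi below has slope at least K * K / 2 and satisfies |psi t| <= |K| e, so that it
   changes sign within distance A e of t. *)
set (A := 4 / Rabs K).
assert (HA : 0 < A) by (apply Rdiv_lt_0_compat; lra).
assert (HAK : A * Rabs K = 4) by (unfold A; field; lra).
set (w1 := fun t e => p1 t + e * n1 t); set (w2 := fun t e => p2 t + e * n2 t).
destruct (positive_nearby (fun t x e =>
   K * (w1 t e * Derive p2 x - w2 t e * Derive p1 x) - K * K / 2) 0 0 0)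
  as (d1 & Hd1 & Q1).
{ unfold w1, w2; continuity_3. }
{ unfold w1, w2; rewrite E1, E2, F1, F2.
  replace (K * _ - _) with (K * K / 2) by (unfold K, k; field); nra. }
(* The normal is radial at the start, so the cross product vanishes there. *)
destruct (positive_nearby (fun t x e => 1 - (n1 t * p2 t - n2 t * p1 t) *
   (n1 t * p2 t - n2 t * p1 t)) 0 0 0) as (d2 & Hd2 & Q2).
{ continuity_3. }
{ rewrite E1, E2, F1, F2; ring_simplify; lra. }
destruct (positive_nearby (fun t x e => w1 t e * p1 x + w2 t e * p2 x) 0 0 0)
  as (d3 & Hd3 & Q3).
{ unfold w1, w2; continuity_3. }
{ unfold w1, w2; rewrite E1, E2, F1, F2.
  replace (_ + _) with (Rad * Rad * (fst c * fst c + snd c * snd c)) by ring.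
  rewrite Hc; nra. }
destruct (positive_nearby (fun t x e => sig * (w1 t e * n1 t + w2 t e * n2 t)) 0 0 0)
  as (d4 & Hd4 & Q4).
{ unfold w1, w2; continuity_3. }
{ unfold w1, w2; rewrite E1, E2, F1, F2.
  replace (_ * _) with (Rad * (sig * sig) * (fst c * fst c + snd c * snd c)) by ring.
  rewrite Hc, Hs; lra. }
destruct (positive_nearby (fun t x e =>
   / (2 * A) * / (2 * A) - (n1 t * Derive p1 x + n2 t * Derive p2 x) *
   (n1 t * Derive p1 x + n2 t * Derive p2 x)) 0 0 0) as (d5 & Hd5 & Q5).
{ continuity_3. }
{ rewrite F1, F2.
  replace (_ - _) with (/ (2 * A) * / (2 * A) -
     sig * sig * (fst c * Derive p1 0 + snd c * Derive p2 0) *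
     (fst c * Derive p1 0 + snd c * Derive p2 0)) by ring.
  rewrite Ht. assert (0 < / (2 * A)) by (apply Rinv_0_lt_compat; lra). nra. }
set (m := Rmin D (Rmin d1 (Rmin d2 (Rmin d3 (Rmin d4 d5))))).
assert (Hm : 0 < m) by (unfold m; repeat apply Rmin_glb_lt; assumption).
assert (HmD : m <= D /\ m <= d1 /\ m <= d2 /\ m <= d3 /\ m <= d4 /\ m <= d5).
{ unfold m; repeat split;
   repeat first [apply Rle_refl | apply Rmin_l | eapply Rle_trans; [apply Rmin_r|]]. }
destruct HmD as (Hm0 & Hm1 & Hm2 & Hm3 & Hm4 & Hm5); clearbody m.
exists (m / (1 + A)); split; [apply Rdiv_lt_0_compat; lra|].
intros t e Htm Hem.
assert (HmA : m / (1 + A) * (1 + A) = m) by (field; lra).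
assert (Hsm : m / (1 + A) < m) by nra.
assert (HeA : Rabs t + A * e < m) by nra.
assert (Ht' : Rabs (t - 0) < m) by (rewrite Rminus_0_r; lra).
assert (He' : Rabs (e - 0) < m) by (rewrite Rminus_0_r, Rabs_pos_eq; lra).
assert (Hnear : forall x, t - A * e <= x <= t + A * e -> Rabs (x - 0) < m).
{ intros x Hx; rewrite Rminus_0_r; apply Rabs_def1; apply Rabs_def2 in Htm;
  unfold Rabs in HeA; destruct (Rcase_abs t); nra. }
clear Htm Hsm HmA.
(* The zeros of psi are the parameters x for which p x lies on the line through
   the centre and w. *)
pose (psi := fun x => K * (w1 t e * p2 x - w2 t e * p1 x)).
assert (Dpsi : forall x, is_derive psi x
   (K * (w1 t e * Derive p2 x - w2 t e * Derive p1 x))).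
{ intros x; unfold psi; destruct (Hd x) as [X1 X2].
  auto_derive; [tauto|]; now rewrite !Rmult_1_l. }
assert (Epsi : forall x, ex_derive psi x) by (intros x; eexists; apply Dpsi).
assert (Hpt : Rabs (psi t) <= Rabs K * e).
{ replace (psi t) with (K * (e * (n1 t * p2 t - n2 t * p1 t)))
    by (unfold psi, w1, w2; ring).
  rewrite Rabs_mult; apply Rmult_le_compat_l; [lra|].
  rewrite Rabs_mult, (Rabs_pos_eq e) by lra.
  assert (Z := Q2 t 0 e (Rlt_le_trans _ _ _ Ht' Hm2)); simpl in Z.
  rewrite Rminus_0_r, Rabs_R0 in Z; specialize (Z Hd2 (Rlt_le_trans _ _ _ He' Hm2)).
  assert (Rabs (n1 t * p2 t - n2 t * p1 t) <= 1) by (apply Rabs_le; nra). nra. }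
assert (Hgrow : forall x, t - A * e <= x <= t + A * e -> K * K / 2 <= Derive psi x).
{ intros x Hx; rewrite (is_derive_unique _ _ _ (Dpsi x)).
  assert (Z := Q1 t x e); simpl in Z.
  assert (Rabs (x - 0) < m) by now apply Hnear.
  assert (0 < K * (w1 t e * Derive p2 x - w2 t e * Derive p1 x) - K * K / 2)
    by (apply Z; lra). lra. }
assert (HAe : 0 < A * e) by nra.
apply Rabs_le_between in Hpt.
assert (Hhi : 0 <= psi (t + A * e)).
{ destruct (mean_value psi t (t + A * e) Epsi) as (x & Hx & Ex).
  rewrite Rmin_left, Rmax_right in Hx by lra.
  assert (G := Hgrow x ltac:(lra)).
  assert (K * K / 2 * (A * e) <= Derive psi x * (A * e)) by (apply Rmult_le_compat_r; lra).
  assert (K * K / 2 * (A * e) = 2 * Rabs K * e)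
    by (rewrite HKK; replace (Rabs K * Rabs K / 2 * (A * e)) with
         ((A * Rabs K) * Rabs K * e / 2) by field; rewrite HAK; field).
  nra. }
assert (Hlo : psi (t - A * e) <= 0).
{ destruct (mean_value psi (t - A * e) t Epsi) as (x & Hx & Ex).
  rewrite Rmin_left, Rmax_right in Hx by lra.
  assert (G := Hgrow x ltac:(lra)).
  assert (K * K / 2 * (A * e) <= Derive psi x * (A * e)) by (apply Rmult_le_compat_r; lra).
  assert (K * K / 2 * (A * e) = 2 * Rabs K * e)
    by (rewrite HKK; replace (Rabs K * Rabs K / 2 * (A * e)) with
         ((A * Rabs K) * Rabs K * e / 2) by field; rewrite HAK; field).
  nra. }
destruct (IVT_gen psi (t - A * e) (t + A * e) 0) as (x & Hx & Zx).
{ intros y; apply continuity_pt_filterlim, (ex_derive_continuous psi), Epsi. }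
{ rewrite Rmin_left, Rmax_right by lra; lra. }
rewrite Rmin_left, Rmax_right in Hx by lra.
assert (Hxm := Hnear x Hx).
assert (Cross : w1 t e * p2 x = w2 t e * p1 x).
{ unfold psi in Zx; apply Rmult_integral in Zx; lra. }
assert (Hww : 0 < w1 t e * p1 x + w2 t e * p2 x) by (apply (Q3 t x e); lra).
assert (Hwn : 0 < sig * (w1 t e * n1 t + w2 t e * n2 t)) by (apply (Q4 t x e); lra).
assert (Hw : 0 < w1 t e * w1 t e + w2 t e * w2 t e).
{ destruct (Req_dec (w1 t e) 0) as [Z1|Z1]; [|nra].
  destruct (Req_dec (w2 t e) 0) as [Z2|Z2]; [|nra].
  rewrite Z1, Z2 in Hww; lra. }
set (al := (w1 t e * p1 x + w2 t e * p2 x) / (w1 t e * w1 t e + w2 t e * w2 t e)).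
assert (A1 : p1 x = al * w1 t e).
{ apply (Rmult_eq_reg_r (w1 t e * w1 t e + w2 t e * w2 t e)); [|lra].
  transitivity ((w1 t e * p1 x + w2 t e * p2 x) * w1 t e
    - w2 t e * (w1 t e * p2 x - w2 t e * p1 x)); [ring|].
  rewrite Cross; unfold al; field; lra. }
assert (A2 : p2 x = al * w2 t e).
{ apply (Rmult_eq_reg_r (w1 t e * w1 t e + w2 t e * w2 t e)); [|lra].
  transitivity ((w1 t e * p1 x + w2 t e * p2 x) * w2 t e
    + w1 t e * (w1 t e * p2 x - w2 t e * p1 x)); [ring|].
  rewrite Cross; unfold al; field; lra. }
exists x, al; repeat split.
- rewrite Rminus_0_r in Hxm; lra.
- now apply Rdiv_lt_0_compat.
- pose (h := fun y => n1 t * p1 y + n2 t * p2 y).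
  assert (Dh : forall y, is_derive h y (n1 t * Derive p1 y + n2 t * Derive p2 y)).
  { intros y; unfold h; destruct (Hd y) as [X1 X2].
    auto_derive; [tauto|]; now rewrite !Rmult_1_l. }
  destruct (mean_value h t x) as (y & Hy & Ey); [intros y; eexists; apply Dh|].
  rewrite (is_derive_unique _ _ _ (Dh y)) in Ey.
  assert (Hyx : t - A * e <= y <= t + A * e).
  { unfold Rmin, Rmax in Hy; destruct (Rle_dec t x); lra. }
  assert (Sl : 0 < / (2 * A) * / (2 * A) - (n1 t * Derive p1 y + n2 t * Derive p2 y) *
     (n1 t * Derive p1 y + n2 t * Derive p2 y)).
  { assert (Hym := Hnear y Hyx); apply (Q5 t y e); lra. }
  set (sl := n1 t * Derive p1 y + n2 t * Derive p2 y) in *.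
  assert (Hi : 0 < / (2 * A)) by (apply Rinv_0_lt_compat; lra).
  assert (Rabs sl <= / (2 * A)) by (apply Rabs_le; nra).
  assert (Rabs (x - t) <= A * e) by (apply Rabs_le; lra).
  assert (Hh : Rabs (h x - h t) <= e / 2).
  { rewrite Ey, Rabs_mult.
    replace (e / 2) with (/ (2 * A) * (A * e)) by (field; lra).
    apply Rmult_le_compat; trivial; apply Rabs_pos. }
  apply Rabs_le_between in Hh.
  assert (Key : (1 - al) * (w1 t e * n1 t + w2 t e * n2 t) = e - (h x - h t)).
  { transitivity (w1 t e * n1 t + w2 t e * n2 t - (n1 t * p1 x + n2 t * p2 x));
      [rewrite A1, A2; ring|].
    unfold h, w1, w2.
    transitivity (e * (n1 t * n1 t + n2 t * n2 t) + (n1 t * p1 t + n2 t * p2 t)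
      - (n1 t * p1 x + n2 t * p2 x)); [ring|rewrite Hu'; ring]. }
  assert (0 < sig * (1 - al) * (sig * (w1 t e * n1 t + w2 t e * n2 t))).
  { replace (_ * _) with (sig * sig * ((1 - al) * (w1 t e * n1 t + w2 t e * n2 t)))
      by ring. rewrite Hs, Key; lra. }
  nra.
- rewrite Hp, A1, A2; reflexivity.
Qed.

(** An outward offset of the strand [p] and an inward offset of the strand [q] cannot
    meet: on the ray through a common point, [p] would be strictly closer to the
    centre than [q]. *)
Lemma offsets_disjoint (Rad : R) (c : R * R) (p n q m : R -> R * R) (D : R) :
  0 < Rad -> strand Rad 1 c p n -> strand Rad (-1) c q m -> 0 < D ->
  (forall x y k, Rabs x < D -> Rabs y < D -> 0 < k ->
     p x = (k * vfst q y, k * vsnd q y) -> 1 <= k) ->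
  exists d, 0 < d /\ forall x y e, Rabs x < d -> Rabs y < d -> 0 < e < d ->
    vfst p x + e * vfst n x = vfst q y + e * vfst m y ->
    vsnd p x + e * vsnd n x = vsnd q y + e * vsnd m y -> False.
Proof.
intros HR Sp Sq HD Hrad.
destruct (offset_on_ray Rad 1 c p n D HR ltac:(lra) Sp HD) as (d1 & Hd1 & H1).
destruct (offset_on_ray Rad (-1) c q m D HR ltac:(lra) Sq HD) as (d2 & Hd2 & H2).
exists (Rmin d1 d2); split; [now apply Rmin_glb_lt|].
intros x y e Hx Hy He Ee1 Ee2.
assert (M1 := Rmin_l d1 d2); assert (M2 := Rmin_r d1 d2).
destruct (H1 x e ltac:(lra) ltac:(lra)) as (x' & al & Hx' & Hal & Lal & Ex).
destruct (H2 y e ltac:(lra) ltac:(lra)) as (y' & be & Hy' & Hbe & Lbe & Ey).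
assert (1 <= al / be).
{ apply (Hrad x' y' _ Hx' Hy'); [now apply Rdiv_lt_0_compat|].
  unfold vfst at 1, vsnd at 1; rewrite Ex, Ey, Ee1, Ee2; simpl.
  f_equal; field; lra. }
assert (al / be * be = al) by (field; lra). nra.
Qed.

(** * Functions of class C^1 and the normal field *)

Lemma Ck_derivable (k j : nat) (f : R -> R) (x : R) :
  Ck k f -> (j < k)%nat -> ex_derive (Derive_n f j) x.
Proof. intros [H _] Hj; exact (H (S j) x Hj). Qed.

Lemma Ck_Derive_n (k j : nat) (f : R -> R) (x : R) :
  Ck k f -> (j <= k)%nat -> continuous (Derive_n f j) x.
Proof.
intros Hf Hj; destruct (Nat.eq_dec j k) as [->|Hn]; [apply Hf|].
apply (ex_derive_continuous (Derive_n f j)), (Ck_derivable k); [exact Hf|lia].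
Qed.

Lemma Ck1_iff (f : R -> R) :
  Ck 1 f <-> forall x, ex_derive f x /\ continuous (Derive f) x.
Proof.
split.
- intros Hf x; split; [exact (Ck_derivable 1 0 f x Hf ltac:(lia))|].
  exact (Ck_Derive_n 1 1 f x Hf ltac:(lia)).
- intros H; split; [|intros x; apply (proj2 (H x))].
  intros [|[|j]] x Hj; [exact I|apply (proj1 (H x))|lia].
Qed.

Lemma Ck_le (j k : nat) (f : R -> R) : (j <= k)%nat -> Ck k f -> Ck j f.
Proof.
intros Hjk Hf; split; [intros i x Hi; apply (proj1 Hf); lia|].
intros x; now apply (Ck_Derive_n k).
Qed.

Lemma Ck2_Derive (f : R -> R) : Ck 2 f -> Ck 1 (Derive f).
Proof.
intros Hf; apply Ck1_iff; intros x; split; [exact (Ck_derivable 2 1 f x Hf ltac:(lia))|].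
exact (Ck_Derive_n 2 2 f x Hf ltac:(lia)).
Qed.

Lemma Ck1_const (k : R) : Ck 1 (fun _ => k).
Proof.
apply Ck1_iff; intros x; split; [apply ex_derive_const|].
apply (continuous_ext (fun _ => 0)); [|apply continuous_const].
intros y; symmetry; apply Derive_const.
Qed.

Lemma Ck1_plus (f g : R -> R) : Ck 1 f -> Ck 1 g -> Ck 1 (fun x => f x + g x).
Proof.
rewrite !Ck1_iff; intros Hf Hg x; destruct (Hf x) as [Hf1 Hf2], (Hg x) as [Hg1 Hg2].
split; [now apply (ex_derive_plus f g)|].
apply (continuous_ext (fun y => Derive f y + Derive g y)).
- intros y; symmetry; apply Derive_plus; [apply Hf|apply Hg].
- now apply continuous_Rplus.
Qed.

Lemma Ck1_mult (f g : R -> R) : Ck 1 f -> Ck 1 g -> Ck 1 (fun x => f x * g x).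
Proof.
rewrite !Ck1_iff; intros Hf Hg x; destruct (Hf x) as [Hf1 Hf2], (Hg x) as [Hg1 Hg2].
split; [now apply ex_derive_mult|].
apply (continuous_ext (fun y => Derive f y * g y + f y * Derive g y)).
- intros y; symmetry; apply Derive_mult; [apply Hf|apply Hg].
- apply continuous_Rplus; apply continuous_Rmult; trivial.
  + now apply (ex_derive_continuous g).
  + now apply (ex_derive_continuous f).
Qed.

Lemma Ck1_inv_sqrt (f : R -> R) :
  (forall x, 0 < f x) -> Ck 1 f -> Ck 1 (fun x => / sqrt (f x)).
Proof.
rewrite !Ck1_iff; intros Hp Hf.
assert (Hs : forall x, sqrt (f x) <> 0)
  by (intros x; apply Rgt_not_eq, sqrt_lt_R0, Hp).
assert (HD : forall x, is_derive (fun y => / sqrt (f y)) x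
   (- (Derive f x * / 2) * (/ sqrt (f x) * / sqrt (f x) * / sqrt (f x)))).
{ intros x; assert (Hx := Hs x); auto_derive;
    [repeat split; [apply Hf|apply Hp|apply Hs]|].
  change (Derive (fun y : R => f y) x) with (Derive f x); field; exact Hx. }
intros x; split; [eexists; apply HD|].
apply (continuous_ext (fun x =>
   - (Derive f x * / 2) * (/ sqrt (f x) * / sqrt (f x) * / sqrt (f x)))).
{ intros y; symmetry; apply is_derive_unique, HD. }
assert (Hc : continuous (fun y => / sqrt (f y)) x)
  by (apply (ex_derive_continuous (fun y => / sqrt (f y))); eexists; apply HD).
apply continuous_Rmult.
- apply continuous_Ropp, continuous_Rmult; [apply Hf|apply continuous_const].
- repeat apply continuous_Rmult; exact Hc.
Qed.

Lemma continuous_components (n : R -> R * R) (s : R) :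
  continuous n s -> continuous (vfst n) s /\ continuous (vsnd n) s.
Proof.
intros Hn; split.
- apply (continuous_comp n fst); [exact Hn|destruct (n s); apply continuous_fst].
- apply (continuous_comp n snd); [exact Hn|destruct (n s); apply continuous_snd].
Qed.

(** By the intermediate value theorem; this makes a continuous unit normal field
    a globally fixed rotation of the tangent. *)
Lemma sign_constant (f : R -> R) :
  (forall x, continuous f x) -> (forall x, f x * f x = 1) -> forall x y, f x = f y.
Proof.
intros Hc H1 x y; destruct (Req_dec (f x) (f y)) as [|Hn]; [assumption|exfalso].
assert (Hx := H1 x); assert (Hy := H1 y).
assert (f x + f y = 0) by nra.
destruct (IVT_gen f x y 0) as (z & _ & Hz).
- intros z; apply continuity_pt_filterlim, Hc.
- unfold Rmin, Rmax; destruct (Rle_dec (f x) (f y)); lra.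
- assert (Q := H1 z); rewrite Hz in Q; lra.
Qed.

Lemma nonzero_dot (v : R * R) : v <> (0, 0) -> 0 < fst v * fst v + snd v * snd v.
Proof.
destruct v as [a b]; simpl; intros Hv.
destruct (Req_dec a 0) as [->|Ha]; [|nra].
destruct (Req_dec b 0) as [->|Hb]; [congruence|nra].
Qed.

(** A continuous unit normal is a constant sign times the rotated unit tangent, so
    it is as smooth as the derivative of the curve. *)
Lemma unit_normal_C1 (p n : R -> R * R) :
  Ck 1 (Derive (vfst p)) -> Ck 1 (Derive (vsnd p)) ->
  (forall s, dvec p s <> (0, 0)) ->
  (forall s, continuous n s) -> (forall s, dot (n s) (n s) = 1) ->
  (forall s, dot (n s) (dvec p s) = 0) ->
  vCk 1 n.
Proof.
intros H1 H2 Hreg Hc Hu Hn.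
set (q := fun s => Derive (vfst p) s * Derive (vfst p) s
                 + Derive (vsnd p) s * Derive (vsnd p) s).
assert (Hq : forall s, 0 < q s) by (intros s; apply (nonzero_dot _ (Hreg s))).
set (r := fun s => / sqrt (q s)).
assert (Hr : Ck 1 r)
  by (apply Ck1_inv_sqrt; [exact Hq|]; apply Ck1_plus; now apply Ck1_mult).
assert (Hqr : forall s, q s * r s * r s = 1).
{ intros s; unfold r; rewrite <- (sqrt_sqrt (q s)) at 1 by (apply Rlt_le, Hq).
  field; apply Rgt_not_eq, sqrt_lt_R0, Hq. }
set (sg := fun s => (vsnd n s * Derive (vfst p) s - vfst n s * Derive (vsnd p) s) * r s).
assert (En : forall s, vfst n s = - sg s * (Derive (vsnd p) s * r s) /\
                       vsnd n s = sg s * (Derive (vfst p) s * r s)).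
{ intros s; assert (Q := Hqr s); assert (N := Hn s); unfold dot, dvec in N; simpl in N.
  fold (vfst n s) (vsnd n s) in N; unfold sg, q in *.
  revert Q N; generalize (Derive (vfst p) s), (Derive (vsnd p) s), (r s),
    (vfst n s), (vsnd n s); intros a b t n1 n2 Q N; split.
  - transitivity (n1 * ((a * a + b * b) * t * t)
      - (n1 * a + n2 * b) * a * t * t); [rewrite Q, N|]; ring.
  - transitivity (n2 * ((a * a + b * b) * t * t)
      - (n1 * a + n2 * b) * b * t * t); [rewrite Q, N|]; ring. }
assert (Hsg : forall s, sg s * sg s = 1).
{ intros s; destruct (En s) as [A1 A2]; assert (U := Hu s); unfold dot in U.
  fold (vfst n s) (vsnd n s) in U; rewrite A1, A2 in U.
  rewrite <- U; transitivity (sg s * sg s * (q s * r s * r s));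
    [rewrite Hqr; ring|unfold q; ring]. }
assert (Csg : forall s, continuous sg s).
{ intros s; destruct (continuous_components n s (Hc s)) as [N1 N2].
  assert (D1 : continuous (Derive (vfst p)) s)
    by (apply (ex_derive_continuous (Derive (vfst p))), (proj1 (Ck1_iff _) H1)).
  assert (D2 : continuous (Derive (vsnd p)) s)
    by (apply (ex_derive_continuous (Derive (vsnd p))), (proj1 (Ck1_iff _) H2)).
  assert (D3 : continuous r s)
    by (apply (ex_derive_continuous r), (proj1 (Ck1_iff _) Hr)).
  unfold sg; apply continuous_Rmult; [apply continuous_Rminus|exact D3];
    apply continuous_Rmult; assumption. }
assert (Ksg := sign_constant sg Csg Hsg).
split.
- replace (vfst n) with (fun s => - sg 0 * (Derive (vsnd p) s * r s)).
  + apply Ck1_mult; [apply Ck1_const|now apply Ck1_mult].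
  + apply functional_extensionality; intros s; rewrite (Ksg 0 s); symmetry; apply En.
- replace (vsnd n) with (fun s => sg 0 * (Derive (vfst p) s * r s)).
  + apply Ck1_mult; [apply Ck1_const|now apply Ck1_mult].
  + apply functional_extensionality; intros s; rewrite (Ksg 0 s); symmetry; apply En.
Qed.

(** The curve seen from the centre (Rad, 0) of the circle. *)
Definition centred (Rad : R) (p : R -> R * R) (s : R) : R * R :=
  (vfst p s - Rad, vsnd p s).

Lemma dvec_centred (Rad : R) (p : R -> R * R) (s : R) :
  (forall x, ex_derive (vfst p) x) -> dvec (centred Rad p) s = dvec p s.
Proof.
intros Hp; unfold dvec; f_equal.
transitivity (Derive (fun x => vfst p x - Rad) s); [reflexivity|].
rewrite Derive_minus, Derive_const; [ring|apply Hp|apply ex_derive_const].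
Qed.

Lemma vCk1_centred (Rad : R) (p : R -> R * R) : vCk 1 p -> vCk 1 (centred Rad p).
Proof.
intros [H1 H2]; split; [|exact H2].
exact (Ck1_plus (vfst p) (fun _ => - Rad) H1 (Ck1_const _)).
Qed.

Lemma vanishes_on_closure (f : R -> R) (a b : R) :
  a < b -> (forall x, continuous f x) -> (forall x, a < x < b -> f x = 0) ->
  forall x, a <= x <= b -> f x = 0.
Proof.
intros Hab Hc H0 x Hx; destruct (Req_dec (f x) 0) as [|Hn]; [assumption|exfalso].
destruct (positive_nearby_1 (fun y => f y * f y) x) as (d & Hd & Hp); [| nra |].
{ apply continuous_Rmult; apply Hc. }
set (h := Rmin d (b - a) / 3).
assert (0 < Rmin d (b - a)) by (apply Rmin_glb_lt; lra).
assert (Rmin d (b - a) <= d) by apply Rmin_l.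
assert (Rmin d (b - a) <= b - a) by apply Rmin_r.
destruct (Rlt_dec x ((a + b) / 2)).
- assert (P := Hp (x + h) ltac:(replace (x + h - x) with h by ring;
    rewrite Rabs_pos_eq; unfold h; lra)); simpl in P.
  rewrite H0 in P; [lra|unfold h; split; lra].
- assert (P := Hp (x - h) ltac:(replace (x - h - x) with (- h) by ring;
    rewrite Rabs_Ropp, Rabs_pos_eq; unfold h; lra)); simpl in P.
  rewrite H0 in P; [lra|unfold h; split; lra].
Qed.

(** The radius vector is orthogonal to the tangent over the open arc, hence by
    continuity also at its endpoints, and so is the normal; in the plane
    they are parallel. *)
Lemma normal_on_circle (Rad sig : R) (p n : R -> R * R) (a b : R) :
  0 < Rad -> sig * sig = 1 -> vCk 1 p -> a < b ->
  (forall s, a <= s <= b -> dot (p s) (p s) = Rad * Rad) ->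
  (forall s, dvec p s <> (0, 0)) -> (forall s, dot (n s) (n s) = 1) ->
  (forall s, dot (n s) (dvec p s) = 0) ->
  (forall s, a <= s <= b -> 0 < sig * dot (n s) (p s)) ->
  forall s, a <= s <= b ->
    dot (p s) (dvec p s) = 0 /\
    p s = (sig * Rad * fst (n s), sig * Rad * snd (n s)).
Proof.
intros HR Hsg [C1 C2] Hab Hcirc Hreg Hu Hn Hpos.
rewrite Ck1_iff in C1, C2.
assert (Htan : forall s, a <= s <= b -> dot (p s) (dvec p s) = 0).
{ apply vanishes_on_closure; [exact Hab| |].
  - intros x; unfold dot, dvec; simpl.
    apply continuous_Rplus; apply continuous_Rmult; [|apply C1| |apply C2].
    + apply (ex_derive_continuous (vfst p)), C1.
    + apply (ex_derive_continuous (vsnd p)), C2.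
  - intros x Hx.
    assert (D : is_derive (fun y => vfst p y * vfst p y + vsnd p y * vsnd p y) x
        (2 * dot (p x) (dvec p x))).
    { destruct (C1 x) as [X1 _], (C2 x) as [X2 _]; auto_derive; [tauto|].
      unfold dot, dvec; simpl; fold (vfst p x) (vsnd p x).
      change (Derive (fun y : R => vfst p y) x) with (Derive (vfst p) x).
      change (Derive (fun y : R => vsnd p y) x) with (Derive (vsnd p) x). ring. }
    apply is_derive_unique in D.
    assert (Z : 2 * dot (p x) (dvec p x) = 0); [|lra].
    rewrite <- D, <- (Derive_const (Rad * Rad) x).
    apply Derive_ext_loc.
    apply (filter_imp (fun y => a < y /\ y < b)).
    + intros y Hy; apply (Hcirc y); lra.
    + apply filter_and; [now apply (open_gt a)|now apply (open_lt b)]. }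
intros s Hs; split; [now apply Htan|].
assert (T := Htan s Hs); assert (N := Hn s); assert (U := Hu s).
assert (P := Hpos s Hs); assert (C := Hcirc s Hs); assert (Q := nonzero_dot _ (Hreg s)).
unfold dot in *; revert T N U P C Q.
destruct (p s) as [p1 p2], (n s) as [n1 n2], (dvec p s) as [a1 a2]; simpl.
intros T N U P C Q.
assert (X : n1 * p2 - n2 * p1 = 0).
{ apply (Rmult_eq_reg_r (a1 * a1 + a2 * a2)); [|lra].
  transitivity ((n1 * a1 + n2 * a2) * (a1 * p2 - a2 * p1)
    + (a1 * n2 - a2 * n1) * - (p1 * a1 + p2 * a2)); [ring|rewrite T, N; ring]. }
set (l := n1 * p1 + n2 * p2) in *.
assert (L : (sig * l) * (sig * l) = Rad * Rad).
{ transitivity (sig * sig * ((n1 * n1 + n2 * n2) * (p1 * p1 + p2 * p2)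
    - (n1 * p2 - n2 * p1) * (n1 * p2 - n2 * p1))); [unfold l; ring|].
  rewrite Hsg, U, C, X; ring. }
assert (L' : sig * l = Rad) by nra.
assert (E1 : p1 = l * n1).
{ transitivity ((n1 * n1 + n2 * n2) * p1); [rewrite U; ring|].
  transitivity (l * n1 - n2 * (n1 * p2 - n2 * p1)); [unfold l; ring|rewrite X; ring]. }
assert (E2 : p2 = l * n2).
{ transitivity ((n1 * n1 + n2 * n2) * p2); [rewrite U; ring|].
  transitivity (l * n2 + n1 * (n1 * p2 - n2 * p1)); [unfold l; ring|rewrite X; ring]. }
assert (Hl : sig * Rad = l) by (rewrite <- L'; transitivity (sig * sig * l);
  [ring|rewrite Hsg; ring]).
rewrite Hl; congruence.
Qed.

(** * Strands leaving a circle at a common point *)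

(** The sign [d] lets the same statement describe both directions in which a strand
    can leave an endpoint of the arc. *)
Lemma strand_reparam (Rad sig d s0 : R) (p n : R -> R * R) :
  0 < Rad -> d * d = 1 -> sig * sig = 1 -> vCk 1 p ->
  (forall s, continuous n s) -> (forall s, dot (n s) (n s) = 1) ->
  dot (p s0) (dvec p s0) = 0 -> dvec p s0 <> (0, 0) ->
  p s0 = (sig * Rad * fst (n s0), sig * Rad * snd (n s0)) ->
  strand Rad sig (fst (p s0) / Rad, snd (p s0) / Rad)
    (fun t => p (s0 + d * t)) (fun t => n (s0 + d * t)).
Proof.
intros HR Hd Hs [C1 C2] Hc Hu Ht Hreg Hn; rewrite Ck1_iff in C1, C2.
assert (E0 : s0 + d * 0 = s0) by ring.
assert (Sh : forall (f : R -> R) (x : R), ex_derive f (s0 + d * x) ->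
  is_derive (fun t => f (s0 + d * t)) x (d * Derive f (s0 + d * x))).
{ intros f x Hf; auto_derive; [tauto|].
  change (Derive (fun y : R => f y) (s0 + d * x)) with (Derive f (s0 + d * x)); ring. }
assert (Cs : forall (f : R -> R), continuous f s0 ->
  continuous (fun t => f (s0 + d * t)) 0).
{ intros f Hf; apply (continuous_comp (fun t => s0 + d * t) f); [|now rewrite E0].
  apply (ex_derive_continuous (fun t => s0 + d * t)); auto_derive; exact I. }
assert (Dp : dvec (fun t => p (s0 + d * t)) 0 =
  (d * fst (dvec p s0), d * snd (dvec p s0))).
{ unfold dvec; f_equal; apply is_derive_unique.
  - generalize (Sh (vfst p) 0); rewrite E0; intros Q; apply Q, C1.
  - generalize (Sh (vsnd p) 0); rewrite E0; intros Q; apply Q, C2. }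
destruct (continuous_components n s0 (Hc s0)) as [N1 N2].
split.
- intros x; split; eexists; [apply (Sh (vfst p)), C1|apply (Sh (vsnd p)), C2].
- split; [apply (continuous_ext (fun t => d * Derive (vfst p) (s0 + d * t)))
         |apply (continuous_ext (fun t => d * Derive (vsnd p) (s0 + d * t)))].
  + intros t; symmetry; apply is_derive_unique, (Sh (vfst p)), C1.
  + apply continuous_Rmult; [apply continuous_const|].
    apply (Cs (Derive (vfst p))), C1.
  + intros t; symmetry; apply is_derive_unique, (Sh (vsnd p)), C2.
  + apply continuous_Rmult; [apply continuous_const|].
    apply (Cs (Derive (vsnd p))), C2.
- split; [apply (Cs (vfst n) N1)|apply (Cs (vsnd n) N2)].
- intros x; apply Hu.
- rewrite E0; simpl; rewrite (surjective_pairing (p s0)) at 1; f_equal; field; lra.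
- rewrite E0; simpl; rewrite Hn; simpl; rewrite (surjective_pairing (n s0)) at 1.
  f_equal.
  + transitivity (sig * sig * fst (n s0)); [rewrite Hs; ring|field; lra].
  + transitivity (sig * sig * snd (n s0)); [rewrite Hs; ring|field; lra].
- rewrite Dp; revert Ht; unfold dot; destruct (dvec p s0) as [a1 a2]; cbn [fst snd].
  intros Ht; transitivity (d / Rad * (fst (p s0) * a1 + snd (p s0) * a2));
    [field; lra|rewrite Ht; ring].
- rewrite Dp; intros Z; injection Z; intros Z2 Z1; apply Hreg.
  rewrite (surjective_pairing (dvec p s0)).
  apply Rmult_integral in Z1; apply Rmult_integral in Z2.
  assert (d <> 0) by nra. f_equal; tauto.
Qed.

(** [polar_pt] seen from the centre of the circle. *)
Definition centred_polar (a r : R) : R * R := (- (r * cos a), r * sin a).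

Lemma sin_zero_small (x : R) : - PI < x < PI -> sin x = 0 -> x = 0.
Proof.
intros Hx H0; destruct (Rtotal_order x 0) as [H|[H|H]]; [|exact H|].
- assert (0 < sin (- x)) by (apply sin_gt_0; lra). rewrite sin_neg in *; lra.
- assert (0 < sin x) by (apply sin_gt_0; lra). lra.
Qed.

(** The angles differ by less than PI, so equal directions force equal angles, not
    merely equal angles modulo 2 PI. *)
Lemma polar_same_ray (e d a b r r' k : R) :
  d * d = 1 -> - PI < a - b < PI -> 0 < k -> 0 < r -> 0 < r' ->
  centred_polar (e + d * a) r = (k * fst (centred_polar (e + d * b) r'),
                                 k * snd (centred_polar (e + d * b) r')) ->
  a = b /\ r = k * r'.
Proof.
intros Hd Hab Hk Hr Hr' E; unfold centred_polar in E; simpl in E.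
injection E; intros E2 E1.
assert (X : sin ((e + d * a) - (e + d * b)) = 0).
{ rewrite sin_minus; apply (Rmult_eq_reg_l r); [|lra].
  transitivity (r * sin (e + d * a) * cos (e + d * b)
    + - (r * cos (e + d * a)) * sin (e + d * b)); [ring|rewrite E1, E2; ring]. }
assert (Y : sin (a - b) = 0).
{ assert (D : d = 1 \/ d = - 1) by (destruct (Rle_dec 0 d); [left|right]; nra).
  destruct D as [-> | ->].
  - rewrite <- X; f_equal; ring.
  - replace (a - b) with (- (e + -1 * a - (e + -1 * b))) by ring.
    rewrite sin_neg, X; ring. }
assert (a = b) by (apply sin_zero_small in Y; lra). subst b; split; [reflexivity|].
assert (T := sin2_cos2 (e + d * a)); unfold Rsqr in T.
rewrite <- (Rmult_1_r r), <- T.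
transitivity (r * sin (e + d * a) * sin (e + d * a)
  - - (r * cos (e + d * a)) * cos (e + d * a)); [ring|rewrite E1, E2].
transitivity (k * r' * (sin (e + d * a) * sin (e + d * a)
  + cos (e + d * a) * cos (e + d * a))); [ring|rewrite T; ring].
Qed.

(** Signed distance from the line through the centre at angle [e], positive on the
    side towards which the angle increases ([d = 1]) or decreases ([d = -1]). *)
Definition beyond (e d : R) (v : R * R) : R := d * (sin e * fst v + cos e * snd v).

(** The strand crosses the ray through its starting point transversally. Since it
    lies beyond this ray for positive parameters, it cannot do so for
    negative ones. *)
Lemma strand_before_end (Rad sig e d eta : R) (c : R * R) (p n : R -> R * R) :
  0 < Rad -> d * d = 1 -> strand Rad sig c p n -> 0 < eta ->
  p 0 = centred_polar e Rad ->
  (forall t, 0 < t < eta -> 0 < beyond e d (p t)) ->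
  exists D, 0 < D /\ forall t, Rabs t < D -> t <= 0 -> beyond e d (p t) <= 0.
Proof.
intros HR Hd [Hdiff [C1 C2] _ _ Hst _ Ht Hreg] Heta H0 Hpos.
set (S := fun t => beyond e d (p t)).
assert (DS : forall t, is_derive S t
   (d * (sin e * Derive (vfst p) t + cos e * Derive (vsnd p) t))).
{ intros t; destruct (Hdiff t) as [X1 X2].
  apply (is_derive_ext (fun t => d * (sin e * vfst p t + cos e * vsnd p t)));
    [reflexivity|].
  auto_derive; [tauto|].
  change (Derive (fun y : R => vfst p y) t) with (Derive (vfst p) t).
  change (Derive (fun y : R => vsnd p y) t) with (Derive (vsnd p) t); ring. }
assert (ES : forall t, ex_derive S t) by (intros t; eexists; apply DS).
assert (CS : continuous (Derive S) 0).
{ apply (continuous_ext (fun t =>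
    d * (sin e * Derive (vfst p) t + cos e * Derive (vsnd p) t))).
  - intros t; symmetry; apply is_derive_unique, DS.
  - repeat first [apply continuous_Rmult | apply continuous_Rplus
      | apply continuous_const | assumption]. }
assert (S0 : S 0 = 0) by (unfold S, beyond; rewrite H0; unfold centred_polar; simpl; ring).
assert (Hc : c = (- cos e, sin e)).
{ rewrite Hst in H0; unfold centred_polar in H0; injection H0; intros Z2 Z1.
  rewrite (surjective_pairing c); f_equal; apply (Rmult_eq_reg_l Rad); lra. }
assert (T := sin2_cos2 e); unfold Rsqr in T.
(* The derivative is tangent to the circle, hence transverse to the ray. *)
assert (Hne : Derive S 0 <> 0).
{ rewrite (is_derive_unique _ _ _ (DS 0)); intros Z; apply Hreg.
  rewrite Hc in Ht; unfold dot, dvec in *; simpl in *.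
  set (a := Derive (vfst p) 0) in *; set (b := Derive (vsnd p) 0) in *.
  assert (Z' : sin e * a + cos e * b = 0).
  { apply Rmult_integral in Z; destruct Z as [Z|Z]; [nra|exact Z]. }
  f_equal.
  - transitivity (a * (sin e * sin e + cos e * cos e)); [rewrite T; ring|].
    transitivity (sin e * (sin e * a + cos e * b) - cos e * (- cos e * a + sin e * b));
      [ring|rewrite Z', Ht; ring].
  - transitivity (b * (sin e * sin e + cos e * cos e)); [rewrite T; ring|].
    transitivity (cos e * (sin e * a + cos e * b) + sin e * (- cos e * a + sin e * b));
      [ring|rewrite Z', Ht; ring]. }
destruct (Rlt_dec 0 (Derive S 0)) as [Hp|Hnp].
- destruct (positive_nearby_1 (Derive S) 0 CS Hp) as (D & HD & P).
  exists D; split; [exact HD|]; intros t Ht1 Ht2.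
  destruct (mean_value S t 0 ES) as (x & Hx & E).
  rewrite Rmin_left, Rmax_right in Hx by lra.
  assert (0 < Derive S x).
  { apply P; rewrite Rminus_0_r, Rabs_left1 by lra. rewrite Rabs_left1 in Ht1; lra. }
  change (S t <= 0); rewrite S0 in E; nra.
- exfalso.
  destruct (positive_nearby_1 (fun t => - Derive S t) 0) as (D & HD & P);
    [now apply continuous_Ropp|lra|].
  set (t := Rmin D eta / 2).
  assert (0 < Rmin D eta) by now apply Rmin_glb_lt.
  assert (M1 := Rmin_l D eta); assert (M2 := Rmin_r D eta).
  assert (Ht0 : 0 < t < eta) by (unfold t; lra).
  assert (St := Hpos t Ht0); fold (S t) in St.
  destruct (mean_value S 0 t ES) as (x & Hx & E).
  rewrite Rmin_left, Rmax_right in Hx by lra.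
  assert (0 < - Derive S x).
  { apply P; rewrite Rminus_0_r, Rabs_pos_eq; unfold t in Hx; lra. }
  rewrite S0 in E; nra.
Qed.

(** Points of the two strands on a common ray lie on the same side of the ray
    through the endpoint: before it, where both run on the circle, or
    beyond it, where the graph functions are ordered. *)
Lemma radial_order_at_end (Rad e d delta etal etar : R) (c : R * R)
    (p n q m : R -> R * R) (hl hr : R -> R) (D0 : R) :
  0 < Rad -> d * d = 1 -> strand Rad 1 c p n -> strand Rad (-1) c q m -> 0 < D0 ->
  (forall t, Rabs t < D0 -> t <= 0 -> dot (p t) (p t) = Rad * Rad) ->
  (forall t, Rabs t < D0 -> t <= 0 -> dot (q t) (q t) = Rad * Rad) ->
  0 < delta < PI -> 0 < etal -> 0 < etar ->
  p 0 = centred_polar e Rad -> q 0 = centred_polar e Rad ->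
  (forall t, 0 < t < etal -> exists a, 0 < a < delta /\
     p t = centred_polar (e + d * a) (Rad + hl a)) ->
  (forall t, 0 < t < etar -> exists a, 0 < a < delta /\
     q t = centred_polar (e + d * a) (Rad + hr a)) ->
  (forall a, 0 < a < delta -> - Rad < hr a < hl a) ->
  exists D, 0 < D /\ forall x y k, Rabs x < D -> Rabs y < D -> 0 < k ->
    p x = (k * vfst q y, k * vsnd q y) -> 1 <= k.
Proof.
intros HR Hd Sp Sq HD0 Cp Cq Hdel Hel Her P0 Q0 Gp Gq Hh.
assert (Side : forall a r, 0 < a < delta -> 0 < r ->
   0 < beyond e d (centred_polar (e + d * a) r)).
{ intros a r Ha Hr; unfold beyond, centred_polar; simpl.
  replace (d * _) with (r * (d * sin (e + d * a - e))) by (rewrite sin_minus; ring).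
  apply Rmult_lt_0_compat; [exact Hr|].
  assert (0 < sin a) by (apply sin_gt_0; lra).
  assert (Dd : d = 1 \/ d = - 1) by (destruct (Rle_dec 0 d); [left|right]; nra).
  destruct Dd as [-> | ->].
  - replace (e + 1 * a - e) with a by ring; lra.
  - replace (e + -1 * a - e) with (- a) by ring; rewrite sin_neg; lra. }
assert (Bp : forall t, 0 < t < etal -> 0 < beyond e d (p t)).
{ intros t Ht; destruct (Gp t Ht) as (a & Ha & ->); apply Side; [exact Ha|].
  specialize (Hh a Ha); lra. }
assert (Bq : forall t, 0 < t < etar -> 0 < beyond e d (q t)).
{ intros t Ht; destruct (Gq t Ht) as (a & Ha & ->); apply Side; [exact Ha|].
  specialize (Hh a Ha); lra. }
destruct (strand_before_end Rad 1 e d etal c p n HR Hd Sp Hel P0 Bp) as (D1 & HD1 & K1).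
destruct (strand_before_end Rad (-1) e d etar c q m HR Hd Sq Her Q0 Bq) as (D2 & HD2 & K2).
set (D := Rmin D0 (Rmin (Rmin D1 D2) (Rmin etal etar))).
assert (HD : 0 < D) by (unfold D; repeat apply Rmin_glb_lt; assumption).
assert (HDm : D <= D0 /\ D <= D1 /\ D <= D2 /\ D <= etal /\ D <= etar).
{ assert (X1 := Rmin_l D0 (Rmin (Rmin D1 D2) (Rmin etal etar))).
  assert (X2 := Rmin_r D0 (Rmin (Rmin D1 D2) (Rmin etal etar))).
  assert (X3 := Rmin_l (Rmin D1 D2) (Rmin etal etar)).
  assert (X4 := Rmin_r (Rmin D1 D2) (Rmin etal etar)).
  assert (X5 := Rmin_l D1 D2); assert (X6 := Rmin_r D1 D2).
  assert (X7 := Rmin_l etal etar); assert (X8 := Rmin_r etal etar).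
  unfold D; repeat split; lra. }
exists D; split; [exact HD|]; intros x y k Hx Hy Hk E.
assert (Eb : beyond e d (p x) = k * beyond e d (q y))
  by (rewrite E; unfold beyond, vfst, vsnd; simpl; ring).
destruct (Rle_dec x 0) as [Lx|Lx], (Rle_dec y 0) as [Ly|Ly].
- assert (Np := Cp x ltac:(lra) Lx); assert (Nq := Cq y ltac:(lra) Ly).
  rewrite E in Np; unfold dot in Np, Nq; simpl in Np; fold (vfst q y) (vsnd q y) in Nq.
  assert (Z : k * k * (Rad * Rad) = Rad * Rad) 
    by (transitivity (k * k * (vfst q y * vfst q y + vsnd q y * vsnd q y));
        [rewrite Nq; reflexivity|rewrite <- Np; ring]).
  assert (k * k = 1) by (apply (Rmult_eq_reg_r (Rad * Rad)); nra). nra.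
- assert (B1 := K1 x ltac:(lra) Lx).
  assert (B2 := Bq y ltac:(apply Rabs_def2 in Hy; lra)). nra.
- assert (B1 := Bp x ltac:(apply Rabs_def2 in Hx; lra)).
  assert (B2 := K2 y ltac:(lra) Ly). nra.
- destruct (Gp x ltac:(apply Rabs_def2 in Hx; lra)) as (a & Ha & Ea).
  destruct (Gq y ltac:(apply Rabs_def2 in Hy; lra)) as (b & Hb & Eb').
  unfold vfst, vsnd in E; rewrite Ea, Eb' in E.
  assert (Ra := Hh a Ha); assert (Rb := Hh b Hb).
  apply polar_same_ray in E; [|exact Hd|lra|exact Hk|lra|lra].
  destruct E as [<- E]. nra.
Qed.

(** * The two strands of the reference curve *)

Lemma gam_short (M : closed_curve) (s r : R) : 
  gam M s = gam M r -> Rabs (r - s) < len M -> s = r.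
Proof.
intros E Hs; apply gam_period in E; destruct E as [k ->].
replace (s + IZR k * len M - s) with (IZR k * len M) in Hs by ring.
assert (L := len_pos M); rewrite Rabs_mult, (Rabs_pos_eq (len M)), <- abs_IZR in Hs by lra.
assert (Hk : IZR (Z.abs k) < 1) by nra.
apply lt_IZR in Hk; replace k with 0%Z by lia; ring.
Qed.

Lemma gam_shift (M : closed_curve) (s : R) (k : Z) :
  gam M (s + IZR k * len M) = gam M s.
Proof. symmetry; apply gam_period; now exists k. Qed.

Lemma period_reduction (M : closed_curve) (a s : R) :
  exists k : Z, a <= s + IZR k * len M < a + len M.
Proof.
assert (L := len_pos M).
exists (1 - up ((s - a) / len M))%Z; rewrite minus_IZR.
destruct (archimed ((s - a) / len M)) as [U1 U2].
assert ((s - a) / len M * len M = s - a) by (field; lra). nra.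
Qed.

Section Strands.

Context {M : closed_curve} {F nu : R * R -> R * R} {Rad : R}.
Context (S : reference_curve M F nu Rad).

Let B0 := b0 _ _ _ _ S.
Let B1 := b1 _ _ _ _ S.
Let B2 := b2 _ _ _ _ S.
Let B3 := b3 _ _ _ _ S.
Let p := centred Rad (along M F).
Let n := along M nu.

Lemma reference_C1 : vCk 1 (along M F).
Proof.
destruct (F_C5 _ _ _ _ S) as [H1 H2]; split; apply (Ck_le 1 5); trivial; lia.
Qed.

Lemma reference_normal_C1 : vCk 1 (along M nu).
Proof.
destruct (F_C5 _ _ _ _ S) as [H1 H2]; apply (unit_normal_C1 (along M F)).
- apply Ck2_Derive, (Ck_le 2 5); trivial; lia.
- apply Ck2_Derive, (Ck_le 2 5); trivial; lia.
- apply (F_immersion _ _ _ _ S).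
- apply (nu_continuous _ _ _ _ S).
- apply (nu_unit _ _ _ _ S).
- apply (nu_normal _ _ _ _ S).
Qed.

Lemma dvec_reference_centred (s : R) :
  dvec (centred Rad (along M F)) s = dvec (along M F) s.
Proof. apply dvec_centred, Ck1_iff, reference_C1. Qed.

Lemma circle_arc_norm (em ep : R) (v : R * R) :
  circle_arc Rad em ep v ->
  (fst v - Rad) * (fst v - Rad) + snd v * snd v = Rad * Rad.
Proof.
intros (a & _ & ->); unfold polar_pt; simpl.
assert (T := sin2_cos2 a); unfold Rsqr in T.
transitivity (Rad * Rad * (sin a * sin a + cos a * cos a)); [ring|rewrite T; ring].
Qed.

Lemma normal_on_Il (s : R) : B0 <= s <= B1 ->
  dot (p s) (dvec p s) = 0 /\ p s = (1 * Rad * fst (n s), 1 * Rad * snd (n s)).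
Proof.
revert s; apply (normal_on_circle Rad 1).
- apply (Rad_pos _ _ _ _ S).
- ring.
- apply vCk1_centred, reference_C1.
- apply (b_order _ _ _ _ S).
- intros s Hs; apply (circle_arc_norm (em _ _ _ _ S) (ep _ _ _ _ S) (F (gam M s))).
  apply (proj1 (Il_arc _ _ _ _ S)); now exists s.
- intros s; unfold p; rewrite dvec_reference_centred; apply (F_immersion _ _ _ _ S).
- apply (nu_unit _ _ _ _ S).
- intros s; unfold p; rewrite dvec_reference_centred; apply (nu_normal _ _ _ _ S).
- intros s Hs; assert (P := nu_away_on_Il _ _ _ _ S (gam M s) ltac:(now exists s)).
  replace (dot (n s) (p s)) with (dot (nu (gam M s)) (minus (F (gam M s)) (Rad, 0)));
    [lra|].
  unfold dot, n, p, centred, vfst, vsnd, along, minus, plus, opp; simpl.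
  unfold prod_plus, prod_opp, plus, opp; simpl. ring.
Qed.

Lemma normal_on_Ir (s : R) : B2 <= s <= B3 ->
  dot (p s) (dvec p s) = 0 /\ p s = (-1 * Rad * fst (n s), -1 * Rad * snd (n s)).
Proof.
revert s; apply (normal_on_circle Rad (-1)).
- apply (Rad_pos _ _ _ _ S).
- ring.
- apply vCk1_centred, reference_C1.
- apply (b_order _ _ _ _ S).
- intros s Hs; apply (circle_arc_norm (em _ _ _ _ S) (ep _ _ _ _ S) (F (gam M s))).
  apply (proj1 (Ir_arc _ _ _ _ S)); now exists s.
- intros s; unfold p; rewrite dvec_reference_centred; apply (F_immersion _ _ _ _ S).
- apply (nu_unit _ _ _ _ S).
- intros s; unfold p; rewrite dvec_reference_centred; apply (nu_normal _ _ _ _ S).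
- intros s Hs; assert (P := nu_towards_on_Ir _ _ _ _ S (gam M s) ltac:(now exists s)).
  replace (dot (n s) (p s)) with (dot (nu (gam M s)) (minus (F (gam M s)) (Rad, 0)));
    [lra|].
  unfold dot, n, p, centred, vfst, vsnd, along, minus, plus, opp; simpl.
  unfold prod_plus, prod_opp, plus, opp; simpl. ring.
Qed.

Lemma strand_l (d s : R) : d * d = 1 -> B0 <= s <= B1 ->
  strand Rad 1 (fst (p s) / Rad, snd (p s) / Rad)
    (fun t => p (s + d * t)) (fun t => n (s + d * t)).
Proof.
intros Hd Hs; destruct (normal_on_Il s Hs) as [Ht Hn]; apply strand_reparam; trivial.
- apply (Rad_pos _ _ _ _ S).
- ring.
- apply vCk1_centred, reference_C1.
- apply (nu_continuous _ _ _ _ S).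
- apply (nu_unit _ _ _ _ S).
- unfold p; rewrite dvec_reference_centred; apply (F_immersion _ _ _ _ S).
Qed.

Lemma strand_r (d s : R) : d * d = 1 -> B2 <= s <= B3 ->
  strand Rad (-1) (fst (p s) / Rad, snd (p s) / Rad)
    (fun t => p (s + d * t)) (fun t => n (s + d * t)).
Proof.
intros Hd Hs; destruct (normal_on_Ir s Hs) as [Ht Hn]; apply strand_reparam; trivial.
- apply (Rad_pos _ _ _ _ S).
- ring.
- apply vCk1_centred, reference_C1.
- apply (nu_continuous _ _ _ _ S).
- apply (nu_unit _ _ _ _ S).
- unfold p; rewrite dvec_reference_centred; apply (F_immersion _ _ _ _ S).
Qed.

(** Transfers [offsets_disjoint] to the reference curve, with local parameters
    [s + d1 x] on the outer strand and [r + d2 y] on the inner one. *)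
Lemma offsets_differ_from_order (d1 d2 s r D : R) :
  d1 * d1 = 1 -> d2 * d2 = 1 -> B0 <= s <= B1 -> B2 <= r <= B3 -> 
  F (gam M s) = F (gam M r) -> 0 < D ->
  (forall x y k, Rabs x < D -> Rabs y < D -> 0 < k ->
     p (s + d1 * x) = (k * fst (p (r + d2 * y)), k * snd (p (r + d2 * y))) -> 1 <= k) ->
  exists d, 0 < d /\ forall s' r' e,
    Rabs (s' - s) < d -> Rabs (r' - r) < d -> 0 < e < d ->
    theta F nu (fun _ => e) (gam M s') <> theta F nu (fun _ => e) (gam M r').
Proof.
intros H1 H2 Hs Hr E HD Hord.
assert (Sr := strand_r d2 r H2 Hr).
replace (p r) with (p s) in Sr by
  (unfold p, centred, vfst, vsnd, along; now rewrite E).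
destruct (offsets_disjoint Rad _ _ _ _ _ D (Rad_pos _ _ _ _ S) (strand_l d1 s H1 Hs) Sr HD)
  as (d & Hd & K); [exact Hord|].
exists d; split; [exact Hd|]; intros s' r' e Hs' Hr' He Eth.
injection Eth; intros E2 E1; change plus with Rplus in E1, E2.
assert (A : forall c x y, c * c = 1 -> x + c * (c * (y - x)) = y)
  by (intros c x y Hc; transitivity (x + c * c * (y - x)); [ring|rewrite Hc; ring]).
assert (N : forall c x, c * c = 1 -> Rabs (c * x) = Rabs x).
{ intros c x Hc; rewrite Rabs_mult; replace (Rabs c) with 1; [ring|].
  assert (c = 1 \/ c = -1) as [-> | ->] by (destruct (Rle_dec 0 c); [left|right]; nra).
  - now rewrite Rabs_R1.
  - rewrite Rabs_left; lra. }
apply (K (d1 * (s' - s)) (d2 * (r' - r)) e).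
- now rewrite N.
- now rewrite N.
- exact He.
- unfold vfst; rewrite !A by assumption; unfold p, n, centred; simpl.
  unfold vfst, along; unfold scal in E1; simpl in E1; unfold mult in E1; simpl in E1; lra.
- unfold vsnd; rewrite !A by assumption; unfold p, n, centred; simpl.
  unfold vsnd, along; unfold scal in E2; simpl in E2; unfold mult in E2; simpl in E2; lra.
Qed.

Lemma Il_unique (z w : R * R) :
  closed_arc M B0 B1 z -> closed_arc M B0 B1 w -> F z = F w -> z = w.
Proof.
intros Hz Hw E; destruct (Il_arc _ _ _ _ S) as [A1 A2].
destruct (A2 _ (A1 z Hz)) as (v & _ & U).
transitivity v; [symmetry|]; apply U; auto.
Qed.

Lemma Ir_unique (z w : R * R) :
  closed_arc M B2 B3 z -> closed_arc M B2 B3 w -> F z = F w -> z = w.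
Proof.
intros Hz Hw E; destruct (Ir_arc _ _ _ _ S) as [A1 A2].
destruct (A2 _ (A1 z Hz)) as (v & _ & U).
transitivity v; [symmetry|]; apply U; auto.
Qed.

Lemma Il_param (s r : R) : B0 <= s <= B1 -> B0 <= r <= B1 ->
  F (gam M s) = F (gam M r) -> s = r.
Proof.
intros Hs Hr E; apply (gam_short M).
- apply Il_unique; [now exists s|now exists r|exact E].
- assert (O := b_order _ _ _ _ S); fold B0 B1 B2 B3 in O; apply Rabs_def1; lra.
Qed.

Lemma Ir_param (s r : R) : B2 <= s <= B3 -> B2 <= r <= B3 ->
  F (gam M s) = F (gam M r) -> s = r.
Proof.
intros Hs Hr E; apply (gam_short M).
- apply Ir_unique; [now exists s|now exists r|exact E].
- assert (O := b_order _ _ _ _ S); fold B0 B1 B2 B3 in O; apply Rabs_def1; lra.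
Qed.

Lemma centred_on_Il (s : R) : B0 <= s <= B1 -> dot (p s) (p s) = Rad * Rad.
Proof.
intros Hs; apply (circle_arc_norm (em _ _ _ _ S) (ep _ _ _ _ S) (F (gam M s))).
apply (proj1 (Il_arc _ _ _ _ S)); now exists s.
Qed.

Lemma centred_on_Ir (s : R) : B2 <= s <= B3 -> dot (p s) (p s) = Rad * Rad.
Proof.
intros Hs; apply (circle_arc_norm (em _ _ _ _ S) (ep _ _ _ _ S) (F (gam M s))).
apply (proj1 (Ir_arc _ _ _ _ S)); now exists s.
Qed.

Lemma centred_polar_pt (a r s : R) :
  F (gam M s) = polar_pt Rad a r -> p s = centred_polar a r.
Proof.
intros E; unfold p, centred, vfst, vsnd, along, centred_polar; rewrite E.
unfold polar_pt; simpl; f_equal; ring.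
Qed.

(** At the endpoints of the arc the strands are ordered by the splitting; at its
    interior points both strands are the circle itself. *)
Lemma double_point_opens (s r : R) : B0 <= s <= B1 -> B2 <= r <= B3 ->
  F (gam M s) = F (gam M r) ->
  exists d, 0 < d /\ forall s' r' e,
    Rabs (s' - s) < d -> Rabs (r' - r) < d -> 0 < e < d ->
    theta F nu (fun _ => e) (gam M s') <> theta F nu (fun _ => e) (gam M r').
Proof.
intros Hs Hr E.
assert (O := b_order _ _ _ _ S); fold B0 B1 B2 B3 in O.
assert (HR := Rad_pos _ _ _ _ S).
destruct (Jp_closes _ _ _ _ S) as [Cp1 Cp2]; fold B1 B2 in Cp1, Cp2.
destruct (Jm_closes _ _ _ _ S) as [Cm1 Cm2]; fold B0 B3 in Cm1, Cm2.
assert (Per : gam M (B0 + len M) = gam M B0)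
  by (replace (B0 + len M) with (B0 + IZR 1 * len M) by ring; apply (gam_shift M)).
destruct (Req_dec s B1) as [->|Hs1]; [|destruct (Req_dec s B0) as [->|Hs0]].
- assert (r = B2) as -> by (apply Ir_param; [lra|lra|now rewrite <- E, Cp1, Cp2]).
  destruct (Jp_splits _ _ _ _ S) as (dl & el & er & hl & hr & Hdl & Hel & Her &
    (Gl & _) & (Gr & _) & Hh); fold B1 B2 in Gl, Gr.
  assert (Sr := strand_r (-1) B2 ltac:(ring) Hr).
  replace (p B2) with (p B1) in Sr by
    (unfold p, centred, vfst, vsnd, along; now rewrite E).
  destruct (radial_order_at_end Rad (ep _ _ _ _ S) 1 dl el er _ _ _ _ _ hl hr
    (Rmin (B1 - B0) (B3 - B2)) HR ltac:(ring) (strand_l 1 B1 ltac:(ring) Hs) Sr)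
    as (D & HD & K); trivial.
  + apply Rmin_glb_lt; lra.
  + intros t Ht1 Ht2; apply centred_on_Il; apply Rabs_def2 in Ht1.
    assert (X := Rmin_l (B1 - B0) (B3 - B2)); lra.
  + intros t Ht1 Ht2; apply centred_on_Ir; apply Rabs_def2 in Ht1.
    assert (X := Rmin_r (B1 - B0) (B3 - B2)); lra.
  + apply centred_polar_pt; now rewrite Rmult_0_r, Rplus_0_r.
  + apply centred_polar_pt; now rewrite Rmult_0_r, Rplus_0_r.
  + intros t Ht; destruct (Gl t Ht) as (a & Ha & Ea); exists a; split; [exact Ha|].
    apply centred_polar_pt; now rewrite Rmult_1_l.
  + intros t Ht; destruct (Gr t Ht) as (a & Ha & Ea); exists a; split; [exact Ha|].
    apply centred_polar_pt; replace (B2 + -1 * t) with (B2 - t) by ring; exact Ea.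
  + intros a Ha; apply (Hh a Ha).
  + apply (offsets_differ_from_order 1 (-1) B1 B2 D); trivial; ring.
- assert (r = B3) as -> by (apply Ir_param; [lra|lra|now rewrite <- E, <- Per, Cm1, Cm2]).
  destruct (Jm_splits _ _ _ _ S) as (dl & el & er & hl & hr & Hdl & Hel & Her &
    (Gl & _) & (Gr & _) & Hh); fold B0 B3 in Gl, Gr.
  assert (Sr := strand_r 1 B3 ltac:(ring) Hr).
  replace (p B3) with (p B0) in Sr by
    (unfold p, centred, vfst, vsnd, along; now rewrite E).
  destruct (radial_order_at_end Rad (em _ _ _ _ S) (-1) dl el er _ _ _ _ _ hl hr
    (Rmin (B1 - B0) (B3 - B2)) HR ltac:(ring) (strand_l (-1) B0 ltac:(ring) Hs) Sr)
    as (D & HD & K); trivial.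
  + apply Rmin_glb_lt; lra.
  + intros t Ht1 Ht2; apply centred_on_Il; apply Rabs_def2 in Ht1.
    assert (X := Rmin_l (B1 - B0) (B3 - B2)); lra.
  + intros t Ht1 Ht2; apply centred_on_Ir; apply Rabs_def2 in Ht1.
    assert (X := Rmin_r (B1 - B0) (B3 - B2)); lra.
  + apply centred_polar_pt; now rewrite Rmult_0_r, Rplus_0_r, <- Per.
  + apply centred_polar_pt; now rewrite Rmult_0_r, Rplus_0_r.
  + intros t Ht; destruct (Gl t Ht) as (a & Ha & Ea); exists a; split; [exact Ha|].
    apply centred_polar_pt; rewrite <- Ea, <- (gam_shift M _ 1); do 2 f_equal; ring.
  + intros t Ht; destruct (Gr t Ht) as (a & Ha & Ea); exists a; split; [exact Ha|].
    apply centred_polar_pt; now rewrite Rmult_1_l.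
  + intros a Ha; apply (Hh a Ha).
  + apply (offsets_differ_from_order (-1) 1 B0 B3 D); trivial; ring.
- assert (r <> B2).
  { intros ->; apply Hs1, Il_param; [lra|lra|now rewrite E, Cp1, Cp2]. }
  assert (r <> B3).
  { intros ->; apply Hs0, Il_param; [lra|lra|now rewrite E, <- Per, Cm1, Cm2]. }
  set (D := Rmin (Rmin (s - B0) (B1 - s)) (Rmin (r - B2) (B3 - r))).
  assert (HD : 0 < D) by (unfold D; repeat apply Rmin_glb_lt; lra).
  assert (D <= s - B0 /\ D <= B1 - s /\ D <= r - B2 /\ D <= B3 - r).
  { assert (X1 := Rmin_l (s - B0) (B1 - s)); assert (X2 := Rmin_r (s - B0) (B1 - s)).
    assert (X3 := Rmin_l (r - B2) (B3 - r)); assert (X4 := Rmin_r (r - B2) (B3 - r)).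
    assert (X5 := Rmin_l (Rmin (s - B0) (B1 - s)) (Rmin (r - B2) (B3 - r))).
    assert (X6 := Rmin_r (Rmin (s - B0) (B1 - s)) (Rmin (r - B2) (B3 - r))).
    unfold D; lra. }
  apply (offsets_differ_from_order 1 1 s r D); trivial; [ring|ring|].
  intros x y k Hx Hy Hk Exy; apply Rabs_def2 in Hx; apply Rabs_def2 in Hy.
  assert (Np := centred_on_Il (s + 1 * x) ltac:(lra)).
  assert (Nq := centred_on_Ir (r + 1 * y) ltac:(lra)).
  rewrite Exy in Np; unfold dot in Np, Nq; cbn [fst snd] in Np.
  assert (k * k * (Rad * Rad) = Rad * Rad) by (rewrite <- Np at 2; rewrite <- Nq; ring).
  assert (k * k = 1) by (apply (Rmult_eq_reg_r (Rad * Rad)); nra). nra.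
Qed.

End Strands.

(** * Embeddedness of the offset curves *)

Section Offsets.

Context {M : closed_curve} {F nu : R * R -> R * R} {Rad : R}.
Context (S : reference_curve M F nu Rad).

Let B0 := b0 _ _ _ _ S.
Let B1 := b1 _ _ _ _ S.
Let B2 := b2 _ _ _ _ S.
Let B3 := b3 _ _ _ _ S.
Let f1 := vfst (along M F).
Let f2 := vsnd (along M F).
Let n1 := vfst (along M nu).
Let n2 := vsnd (along M nu).

Lemma vfst_offset (e s : R) :
  vfst (along M (theta F nu (fun _ => e))) s = vfst (along M F) s + e * vfst (along M nu) s.
Proof. reflexivity. Qed.

Lemma vsnd_offset (e s : R) :
  vsnd (along M (theta F nu (fun _ => e))) s = vsnd (along M F) s + e * vsnd (along M nu) s.
Proof. reflexivity. Qed.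

Lemma offset_C1 (e : R) : vCk 1 (along M (theta F nu (fun _ => e))).
Proof.
destruct (reference_C1 S) as [F1 F2], (reference_normal_C1 S) as [N1 N2]; split.
- apply (Ck1_plus _ (fun s => e * vfst (along M nu) s) F1).
  exact (Ck1_mult (fun _ => e) _ (Ck1_const e) N1).
- apply (Ck1_plus _ (fun s => e * vsnd (along M nu) s) F2).
  exact (Ck1_mult (fun _ => e) _ (Ck1_const e) N2).
Qed.

Lemma dvec_offset (e s : R) :
  dvec (along M (theta F nu (fun _ => e))) s =
    (Derive f1 s + e * Derive n1 s, Derive f2 s + e * Derive n2 s).
Proof.
destruct (reference_C1 S) as [F1 F2], (reference_normal_C1 S) as [N1 N2].
rewrite Ck1_iff in F1, F2, N1, N2.
unfold dvec; f_equal.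
- rewrite (Derive_ext _ _ s (vfst_offset e)), Derive_plus, Derive_scal; [reflexivity|apply F1|].
  apply ex_derive_scal, N1.
- rewrite (Derive_ext _ _ s (vsnd_offset e)), Derive_plus, Derive_scal; [reflexivity|apply F2|].
  apply ex_derive_scal, N2.
Qed.

(** The velocity of the offset curve stays close to that of the reference
    curve, so the component along [dvec (along M F) s] stays positive. This gives
    both the immersion property and local injectivity. *)
Lemma offset_velocity_near (s : R) :
  exists d, 0 < d /\ forall x e, Rabs (x - s) < d -> 0 < e < d ->
    0 < dot (dvec (along M F) s) (dvec (along M (theta F nu (fun _ => e))) x).
Proof.
destruct (reference_C1 S) as [F1 F2], (reference_normal_C1 S) as [N1 N2].
rewrite Ck1_iff in F1, F2, N1, N2.
assert (Near : forall a1 a2 b1 b2 : R -> R,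
  continuous a1 s -> continuous a2 s -> continuous b1 s -> continuous b2 s ->
  0 < a1 s * a1 s + a2 s * a2 s ->
  exists d, 0 < d /\ forall x y e, Rabs (x - s) < d -> Rabs (y - s) < d -> Rabs (e - 0) < d ->
    0 < a1 s * (a1 x + e * b1 x) + a2 s * (a2 x + e * b2 x)).
{ intros a1 a2 b1 b2 A1 A2 A3 A4 Hp.
  apply (positive_nearby (fun x _ e => a1 s * (a1 x + e * b1 x) + a2 s * (a2 x + e * b2 x)));
    [continuity_3|lra]. }
destruct (Near (Derive f1) (Derive f2) (Derive n1) (Derive n2)
  (proj2 (F1 s)) (proj2 (F2 s)) (proj2 (N1 s)) (proj2 (N2 s))) as (d & Hd & P).
- exact (nonzero_dot _ (F_immersion _ _ _ _ S s)).
- exists d; split; [exact Hd|]; intros x e Hx He; rewrite dvec_offset.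
  apply (P x s e Hx); [rewrite Rminus_diag, Rabs_R0; exact Hd|].
  rewrite Rminus_0_r, Rabs_pos_eq; lra.
Qed.

Lemma offset_locally_injective (s : R) :
  exists d, 0 < d /\ forall x y e,
    Rabs (x - s) < d -> Rabs (y - s) < d -> 0 < e < d ->
    theta F nu (fun _ => e) (gam M x) = theta F nu (fun _ => e) (gam M y) -> x = y.
Proof.
destruct (offset_velocity_near s) as (d & Hd & P).
exists d; split; [exact Hd|]; intros x y e Hx Hy He Eq.
destruct (offset_C1 e) as [C1 C2]; rewrite Ck1_iff in C1, C2.
set (a := dvec (along M F) s) in *; set (q := along M (theta F nu (fun _ => e))) in *.
set (h := fun z => fst a * vfst q z + snd a * vsnd q z).
assert (Dh : forall z, is_derive h z (dot a (dvec q z))).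
{ intros z; unfold h; destruct (C1 z) as [X1 _], (C2 z) as [X2 _].
  auto_derive; [tauto|]; rewrite !Rmult_1_l; reflexivity. }
destruct (mean_value h x y) as (z & Hz & E); [intros z; eexists; apply Dh|].
rewrite (is_derive_unique _ _ _ (Dh z)) in E.
assert (Hzs : Rabs (z - s) < d).
{ apply Rabs_def2 in Hx; apply Rabs_def2 in Hy.
  unfold Rmin, Rmax in Hz; destruct (Rle_dec x y); apply Rabs_def1; lra. }
assert (Pz := P z e Hzs He); fold q in Pz.
assert (h x = h y) by (unfold h, vfst, vsnd, q, along; now rewrite Eq).
assert (Z : dot a (dvec q z) * (y - x) = 0) by lra.
apply Rmult_integral in Z; destruct Z; lra.
Qed.

Lemma offset_separates (s r : R) : F (gam M s) <> F (gam M r) ->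
  exists d, 0 < d /\ forall x y e,
    Rabs (x - s) < d -> Rabs (y - r) < d -> 0 < e < d ->
    theta F nu (fun _ => e) (gam M x) <> theta F nu (fun _ => e) (gam M y).
Proof.
intros Hne.
destruct (reference_C1 S) as [F1 F2], (reference_normal_C1 S) as [N1 N2].
rewrite Ck1_iff in F1, F2, N1, N2.
assert (Near : forall a1 a2 b1 b2 : R -> R,
  (forall x, ex_derive a1 x) -> (forall x, ex_derive a2 x) ->
  (forall x, ex_derive b1 x) -> (forall x, ex_derive b2 x) ->
  0 < (a1 s - a1 r) * (a1 s - a1 r) + (a2 s - a2 r) * (a2 s - a2 r) ->
  exists d, 0 < d /\ forall x y e, Rabs (x - s) < d -> Rabs (y - r) < d -> Rabs (e - 0) < d ->
   0 < (a1 x + e * b1 x - (a1 y + e * b1 y)) * (a1 x + e * b1 x - (a1 y + e * b1 y)) +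
   (a2 x + e * b2 x - (a2 y + e * b2 y)) * (a2 x + e * b2 x - (a2 y + e * b2 y))).
{ intros a1 a2 b1 b2 A1 A2 A3 A4 Hp.
  apply (positive_nearby (fun x y e =>
   (a1 x + e * b1 x - (a1 y + e * b1 y)) * (a1 x + e * b1 x - (a1 y + e * b1 y)) +
   (a2 x + e * b2 x - (a2 y + e * b2 y)) * (a2 x + e * b2 x - (a2 y + e * b2 y)))).
  - continuity_3; apply (ex_derive_continuous (V := R_NormedModule)); auto.
  - rewrite !Rmult_0_l, !Rplus_0_r; exact Hp. }
destruct (Near f1 f2 n1 n2 (fun x => proj1 (F1 x)) (fun x => proj1 (F2 x))
  (fun x => proj1 (N1 x)) (fun x => proj1 (N2 x))) as (d & Hd & P).
- apply (nonzero_dot (f1 s - f1 r, f2 s - f2 r)); intros Z; injection Z; intros Z2 Z1.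
  apply Hne; rewrite (surjective_pairing (F (gam M s))), (surjective_pairing (F (gam M r))).
  unfold f1, f2, vfst, vsnd, along in Z1, Z2; f_equal; lra.
- exists d; split; [exact Hd|]; intros x y e Hx Hy He Eq.
  assert (Q := P x y e Hx Hy ltac:(rewrite Rminus_0_r, Rabs_pos_eq; lra)); simpl in Q.
  assert (E1 : f1 x + e * n1 x = f1 y + e * n1 y) by exact (f_equal fst Eq).
  assert (E2 : f2 x + e * n2 x = f2 y + e * n2 y) by exact (f_equal snd Eq).
  rewrite E1, E2 in Q; lra.
Qed.

Lemma on_curve_cases (s : R) : exists k : Z,
  let r := s + IZR k * len M in
  B0 <= r <= B1 \/ B1 < r < B2 \/ B2 <= r <= B3 \/ B3 < r < B0 + len M.
Proof.
destruct (period_reduction M B0 s) as [k Hk]; exists k; simpl.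
destruct (Rle_dec (s + IZR k * len M) B1); [lra|].
destruct (Rlt_dec (s + IZR k * len M) B2); [lra|].
destruct (Rle_dec (s + IZR k * len M) B3); lra.
Qed.

(** By the shape of the reference curve, F identifies a point of I_l with a point
    of I_r and makes no other identifications. *)
Lemma offset_opens_at (s r : R) : exists d, 0 < d /\ forall x y e,
    Rabs (x - s) < d -> Rabs (y - r) < d -> 0 < e < d ->
    theta F nu (fun _ => e) (gam M x) = theta F nu (fun _ => e) (gam M y) ->
    gam M x = gam M y.
Proof.
destruct (classic (F (gam M s) = F (gam M r))) as [E|Hne].
2: { destruct (offset_separates s r Hne) as (d & Hd & P).
  exists d; split; [exact Hd|]; intros x y e Hx Hy He Eq; now apply P in Eq. }
destruct (classic (gam M s = gam M r)) as [G|G].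
{ apply gam_period in G; destruct G as [k ->].
  destruct (offset_locally_injective s) as (d & Hd & P).
  exists d; split; [exact Hd|]; intros x y e Hx Hy He Eq.
  assert (Ey : gam M (y + IZR (- k) * len M) = gam M y) by apply (gam_shift M).
  rewrite <- Ey in Eq |- *; f_equal; apply (P x (y + IZR (- k) * len M) e); trivial.
  rewrite opp_IZR; replace (y + - IZR k * len M - s) with (y - (s + IZR k * len M)) by ring.
  exact Hy. }
destruct (on_curve_cases s) as [k Hs], (on_curve_cases r) as [l Hr]; simpl in Hs, Hr.
assert (Gs := gam_shift M s k); assert (Gr := gam_shift M r l).
revert Hs Hr Gs Gr.
set (s0 := s + IZR k * len M); set (r0 := r + IZR l * len M); intros Hs Hr Gs Gr.
rewrite <- Gs, <- Gr in E, G.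
assert (Shift : forall (t : R) (m : Z) (x : R),
  x + IZR m * len M - (t + IZR m * len M) = x - t) by (intros; ring).
destruct Hs as [Hs|[Hs|[Hs|Hs]]], Hr as [Hr|[Hr|[Hr|Hr]]].
- exfalso; apply G; f_equal; now apply (Il_param S).
- exfalso; apply (Jp_arc_disjoint _ _ _ _ S (gam M r0)); [now exists r0|].
  rewrite <- E; apply (proj1 (Il_arc _ _ _ _ S)); now exists s0.
- destruct (double_point_opens S s0 r0 Hs Hr E) as (d & Hd & P).
  exists d; split; [exact Hd|]; intros x y e Hx Hy He Eq; exfalso.
  apply (P (x + IZR k * len M) (y + IZR l * len M) e).
  + unfold s0; now rewrite Shift.
  + unfold r0; now rewrite Shift.
  + exact He.
  + now rewrite !gam_shift.
- exfalso; apply (Jm_arc_disjoint _ _ _ _ S (gam M r0)); [now exists r0|].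
  rewrite <- E; apply (proj1 (Il_arc _ _ _ _ S)); now exists s0.
- exfalso; apply (Jp_arc_disjoint _ _ _ _ S (gam M s0)); [now exists s0|].
  rewrite E; apply (proj1 (Il_arc _ _ _ _ S)); now exists r0.
- exfalso; apply G, (Jp_inj _ _ _ _ S); [now exists s0|now exists r0|exact E].
- exfalso; apply (Jp_arc_disjoint _ _ _ _ S (gam M s0)); [now exists s0|].
  rewrite E; apply (proj1 (Ir_arc _ _ _ _ S)); now exists r0.
- exfalso; apply (Jp_Jm_disjoint _ _ _ _ S (gam M s0) (gam M r0));
    [now exists s0|now exists r0|exact E].
- destruct (double_point_opens S r0 s0 Hr Hs (eq_sym E)) as (d & Hd & P).
  exists d; split; [exact Hd|]; intros x y e Hx Hy He Eq; exfalso.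
  apply (P (y + IZR l * len M) (x + IZR k * len M) e).
  + unfold r0; now rewrite Shift.
  + unfold s0; now rewrite Shift.
  + exact He.
  + now rewrite !gam_shift.
- exfalso; apply (Jp_arc_disjoint _ _ _ _ S (gam M r0)); [now exists r0|].
  rewrite <- E; apply (proj1 (Ir_arc _ _ _ _ S)); now exists s0.
- exfalso; apply G; f_equal; now apply (Ir_param S).
- exfalso; apply (Jm_arc_disjoint _ _ _ _ S (gam M r0)); [now exists r0|].
  rewrite <- E; apply (proj1 (Ir_arc _ _ _ _ S)); now exists s0.
- exfalso; apply (Jm_arc_disjoint _ _ _ _ S (gam M s0)); [now exists s0|].
  rewrite E; apply (proj1 (Il_arc _ _ _ _ S)); now exists r0.
- exfalso; apply (Jp_Jm_disjoint _ _ _ _ S (gam M r0) (gam M s0));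
    [now exists r0|now exists s0|now symmetry].
- exfalso; apply (Jm_arc_disjoint _ _ _ _ S (gam M s0)); [now exists s0|].
  rewrite E; apply (proj1 (Ir_arc _ _ _ _ S)); now exists r0.
- exfalso; apply G, (Jm_inj _ _ _ _ S); [now exists s0|now exists r0|exact E].
Qed.

Lemma vnorm_lt (v : R * R) (e : R) : 0 < e -> (vnorm v < e <-> dot v v < e * e).
Proof.
intros He; unfold vnorm.
assert (P : 0 <= dot v v) by (unfold dot; nra).
assert (Q := sqrt_sqrt _ P); assert (Q' := sqrt_pos (dot v v)); split; intros H; nra.
Qed.

Lemma dot_minus (v w : R * R) : dot (minus v w) (minus v w) =
  (fst v - fst w) * (fst v - fst w) + (snd v - snd w) * (snd v - snd w).
Proof. reflexivity. Qed.

(** Compactness of M: a continuous injection of M is a homeomorphism onto its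
    image. *)
Lemma inverse_continuous (Th : R * R -> R * R) :
  vCk 1 (along M Th) -> inj_on Th (on_curve M) ->
  forall z, on_curve M z -> forall e : R, 0 < e -> exists d : R, 0 < d /\
    forall w, on_curve M w ->
       vnorm (minus (Th w) (Th z)) < d -> vnorm (minus w z) < e.
Proof.
intros [T1 T2] Inj z Hz e He.
destruct (gam_C5 M) as [G1 G2].
apply (Ck_le 1) in G1; [|lia]; apply (Ck_le 1) in G2; [|lia].
assert (Cont : forall f x, Ck 1 f -> continuous f x).
{ intros f x Hf; rewrite Ck1_iff in Hf; now apply (ex_derive_continuous f), Hf. }
set (t1 := vfst (along M Th)) in *; set (t2 := vsnd (along M Th)) in *.
set (g1 := vfst (gam M)) in *; set (g2 := vsnd (gam M)) in *.
(* The small parameter is here the distance between the images. *)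
destruct (uniform_on_square 0 (len M) (fun x _ d =>
   vnorm (minus (Th (gam M x)) (Th z)) < d -> vnorm (minus (gam M x) z) < e))
  as (d & Hd & P).
{ intros x y _ _.
  assert (Cg1 := Cont g1 x G1); assert (Cg2 := Cont g2 x G2).
  assert (Ct1 := Cont t1 x T1); assert (Ct2 := Cont t2 x T2).
  destruct (Rlt_dec (vnorm (minus (gam M x) z)) e) as [Hn|Hf].
  - rewrite vnorm_lt, dot_minus in Hn by exact He.
    destruct (positive_nearby (fun x _ _ => e * e - ((g1 x - fst z) * (g1 x - fst z)
      + (g2 x - snd z) * (g2 x - snd z))) x x 0) as (d & Hd & P).
    { continuity_3. }
    { change (0 < e * e - ((fst (gam M x) - fst z) * (fst (gam M x) - fst z)
        + (snd (gam M x) - snd z) * (snd (gam M x) - snd z))); lra. }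
    exists d; split; [exact Hd|]; intros x' y' d' Hx _ _ _.
    apply vnorm_lt; [exact He|]; rewrite dot_minus.
    specialize (P x' x 0 Hx ltac:(rewrite Rminus_diag, Rabs_R0; exact Hd)
      ltac:(rewrite Rminus_diag, Rabs_R0; exact Hd)).
    unfold g1, g2, vfst, vsnd in P; lra.
  - destruct (positive_nearby (fun x _ d => (t1 x - fst (Th z)) * (t1 x - fst (Th z))
      + (t2 x - snd (Th z)) * (t2 x - snd (Th z)) - d * d) x x 0) as (d & Hd & P).
    { continuity_3. }
    { rewrite Rmult_0_l, Rminus_0_r.
      apply (nonzero_dot (t1 x - fst (Th z), t2 x - snd (Th z))); intros Z.
      injection Z; intros Z2 Z1; apply Hf.
      replace (gam M x) with z.
      - apply vnorm_lt; [exact He|]; rewrite dot_minus; nra.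
      - apply Inj; [exact Hz|now exists x|].
        rewrite (surjective_pairing (Th z)), (surjective_pairing (Th (gam M x))).
        unfold t1, t2, vfst, vsnd, along in Z1, Z2; f_equal; lra. }
    exists d; split; [exact Hd|]; intros x' y' d' Hx _ Hd' Hlt; exfalso.
    rewrite vnorm_lt, dot_minus in Hlt by lra.
    specialize (P x' x d' Hx ltac:(rewrite Rminus_diag, Rabs_R0; exact Hd)
      ltac:(rewrite Rminus_0_r, Rabs_pos_eq; lra)).
    unfold t1, t2, vfst, vsnd, along in P; lra. }
exists (d / 2); split; [lra|]; intros w [s ->] Hlt.
destruct (period_reduction M 0 s) as [k Hk]; rewrite <- (gam_shift M s k) in Hlt |- *.
apply (P _ 0 (d / 2)); trivial; assert (L := len_pos M); lra.
Qed.

Lemma Derive_periodic (f : R -> R) (c s : R) :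
  (forall t, f (t + c) = f t) -> Derive f (s + c) = Derive f s.
Proof.
intros Hf; unfold Derive; f_equal; apply Lim_ext; intros h.
rewrite Hf; replace (s + c + h) with (s + h + c) by ring; now rewrite Hf.
Qed.

Lemma offset_embedding : exists d, 0 < d /\ forall e, 0 < e < d ->
  is_embedding M (theta F nu (fun _ => e)).
Proof.
destruct (uniform_on_square B0 (B0 + len M) (fun x y e =>
   (theta F nu (fun _ => e) (gam M x) = theta F nu (fun _ => e) (gam M y) ->
    gam M x = gam M y) /\ dvec (along M (theta F nu (fun _ => e))) x <> (0, 0)))
  as (d & Hd & P).
{ intros x y _ _.
  destruct (offset_opens_at x y) as (d1 & Hd1 & P1).
  destruct (offset_velocity_near x) as (d2 & Hd2 & P2).
  exists (Rmin d1 d2); split; [now apply Rmin_glb_lt|].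
  assert (M1 := Rmin_l d1 d2); assert (M2 := Rmin_r d1 d2).
  intros x' y' e Hx Hy He; split.
  - apply (P1 x' y' e); lra.
  - intros Z; assert (Q := P2 x' e ltac:(lra) ltac:(lra)); rewrite Z in Q.
    unfold dot in Q; simpl in Q; lra. }
exists d; split; [exact Hd|]; intros e He.
assert (Red : forall s, exists r, B0 <= r <= B0 + len M /\ gam M s = gam M r).
{ intros s; destruct (period_reduction M B0 s) as [k Hk].
  exists (s + IZR k * len M); split; [lra|symmetry; apply gam_shift]. }
assert (Inj : inj_on (theta F nu (fun _ => e)) (on_curve M)).
{ intros z w [s ->] [r ->] Eq.
  destruct (Red s) as (s' & Hs & Es), (Red r) as (r' & Hr & Er); rewrite Es, Er in *.
  now apply (P s' r' e). }
split; [apply offset_C1|split; [|split; [exact Inj|]]].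
- intros s; destruct (period_reduction M B0 s) as [k Hk].
  assert (Q := proj2 (P (s + IZR k * len M) (s + IZR k * len M) e ltac:(lra) ltac:(lra) He)).
  rewrite dvec_offset in Q |- *.
  assert (Sh : forall f : R * R -> R, Derive (fun t => f (gam M t)) (s + IZR k * len M) =
     Derive (fun t => f (gam M t)) s).
  { intros f; apply (Derive_periodic (fun t => f (gam M t))); intros t; now rewrite gam_shift. }
  unfold f1, f2, n1, n2, vfst, vsnd, along in *.
  rewrite !(Sh (fun z => fst (F z))), !(Sh (fun z => snd (F z))),
   !(Sh (fun z => fst (nu z))), !(Sh (fun z => snd (nu z))) in Q; exact Q.
- apply inverse_continuous; [apply offset_C1|exact Inj].
Qed.

End Offsets.

(** * Norms and time derivatives *)

Lemma sup_abs_nonneg (f : R -> R) : 0 <= sup_abs f.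
Proof.
unfold sup_abs; destruct (Lub_Rbar_correct (fun y => exists s : R, y = Rabs (f s))) as [Ub _].
specialize (Ub (Rabs (f 0)) ltac:(now exists 0)).
destruct (Lub_Rbar _) as [l| |]; simpl in *; [|lra|lra].
assert (P := Rabs_pos (f 0)); lra.
Qed.

Lemma CkM_norm_nonneg (M : closed_curve) (k : nat) (f : R * R -> R) : 0 <= CkM_norm M k f.
Proof. apply cond_pos_sum; intros j; apply sup_abs_nonneg. Qed.

(** Boundedness by periodicity is what makes the real-valued supremum meaningful:
    [real] sends an infinite one to 0. *)
Lemma sup_abs_ge (M : closed_curve) (f : R * R -> R) (s : R) :
  (forall x, continuous (along M f) x) -> Rabs (f (gam M s)) <= sup_abs (along M f).
Proof.
intros Hf; assert (L := len_pos M).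
destruct (continuity_ab_maj (fun x => Rabs (along M f x)) 0 (len M)) as (m & Hm & _);
  [lra| |].
{ intros x _; apply continuity_pt_filterlim.
  apply (continuous_comp (along M f) Rabs); [apply Hf|apply continuous_Rabs]. }
unfold sup_abs.
destruct (Lub_Rbar_correct (fun y => exists s : R, y = Rabs (along M f s))) as [Ub Least].
assert (X := Ub (Rabs (f (gam M s))) ltac:(now exists s)).
assert (Y := Least (Rabs (along M f m))).
destruct (Lub_Rbar _) as [l| |]; simpl in *; [exact X| |contradiction].
exfalso; apply Y; intros y (r & ->); simpl.
destruct (period_reduction M 0 r) as [k Hk].
unfold along at 1; rewrite <- (gam_shift M r k); apply Hm; lra.
Qed.

Lemma CkM0_norm_ge (M : closed_curve) (f : R * R -> R) (z : R * R) :
  CkM M 0 f -> on_curve M z -> Rabs (f z) <= CkM_norm M 0 f.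
Proof. intros [_ Hf] [s ->]; now apply sup_abs_ge. Qed.

Lemma sup_abs_const (k : R) : sup_abs (fun _ => k) = Rabs k.
Proof.
unfold sup_abs; rewrite (is_lub_Rbar_unique _ (Finite (Rabs k))); [reflexivity|split].
- intros y (s & ->); simpl; lra.
- intros b Hb; apply Hb; now exists 0.
Qed.

Lemma CkM_norm_const (M : closed_curve) (k : nat) (c : R) :
  CkM_norm M k (fun _ => c) = Rabs c.
Proof.
unfold CkM_norm, along; induction k as [|k IH]; [apply sup_abs_const|].
rewrite tech5, IH.
replace (Derive_n (fun _ : R => c) (S k)) with (fun _ : R => 0).
- rewrite sup_abs_const, Rabs_R0; ring.
- apply functional_extensionality; intros x; symmetry; apply Derive_n_const.
Qed.

Lemma CkM_const (M : closed_curve) (k : nat) (c : R) : CkM M k (fun _ => c).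
Proof.
unfold CkM, along; split; [intros j x _; exact (ex_derive_n_const c j x)|].
intros x; destruct k as [|k]; [apply continuous_const|].
apply (continuous_ext (fun _ => 0)); [|apply continuous_const].
intros y; symmetry; exact (Derive_n_const k c y).
Qed.

Lemma is_dt_iff (T : R) (f : R -> R) (t l : R) :
  is_dt T f t l <-> forall e, 0 < e -> exists d, 0 < d /\
    forall r, 0 <= r <= T -> r <> t -> Rabs (r - t) < d ->
      Rabs ((f r - f t) / (r - t) - l) < e.
Proof.
unfold is_dt; split.
- intros H e He.
  destruct (H (fun y => Rabs (y - l) < e)) as [d Hd].
  { exists (mkposreal e He); intros y Hy; exact Hy. }
  exists d; split; [apply cond_pos|]; intros r Hr Hne Hd'; now apply Hd.
- intros H P [e He]; destruct (H e (cond_pos e)) as (d & Hd & K).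
  exists (mkposreal d Hd); intros r Hr Hne HrT; apply He; now apply K.
Qed.

(** Every time in [0, T] is a limit of other times in [0, T], as [0 < T]. *)
Lemma dt_unique (T : R) (f : R -> R) (t l : R) :
  0 < T -> 0 <= t <= T -> is_dt T f t l -> dt T f t = l.
Proof.
intros HT Ht Hl; apply (iota_unique (V := R_CompleteNormedModule)); [|exact Hl].
intros y Hy; rewrite is_dt_iff in Hl, Hy.
destruct (Req_dec y l) as [|Hne]; [assumption|exfalso].
assert (He : 0 < Rabs (y - l) / 2) by (assert (0 < Rabs (y - l)) by (apply Rabs_pos_lt; lra); lra).
destruct (Hl _ He) as (d1 & Hd1 & K1), (Hy _ He) as (d2 & Hd2 & K2).
set (h := Rmin (Rmin d1 d2) T / 2).
assert (Hm : 0 < Rmin (Rmin d1 d2) T) by (repeat apply Rmin_glb_lt; assumption).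
assert (X1 := Rmin_l (Rmin d1 d2) T); assert (X2 := Rmin_r (Rmin d1 d2) T).
assert (X3 := Rmin_l d1 d2); assert (X4 := Rmin_r d1 d2).
assert (exists r, 0 <= r <= T /\ r <> t /\ Rabs (r - t) = h) as (r & R1 & R2 & R3).
{ destruct (Rle_dec t (T / 2)).
  - exists (t + h); replace (t + h - t) with h by ring.
    rewrite Rabs_pos_eq; unfold h; repeat split; lra.
  - exists (t - h); replace (t - h - t) with (- h) by ring.
    rewrite Rabs_Ropp, Rabs_pos_eq; unfold h; repeat split; lra. }
specialize (K1 r R1 R2 ltac:(rewrite R3; unfold h; lra)).
specialize (K2 r R1 R2 ltac:(rewrite R3; unfold h; lra)).
apply Rabs_def2 in K1; apply Rabs_def2 in K2.
unfold Rabs in *; destruct (Rcase_abs (y - l)); lra.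
Qed.

Lemma C1_in_time_is_dt (M : closed_curve) (T : R) (f : R -> R * R -> R) (t : R) (z : R * R) :
  C1_in_time M T 0 f -> 0 <= t <= T -> on_curve M z ->
  is_dt T (fun r => f r z) t (dtM T f t z).
Proof.
intros ((C & _) & (C' & _) & D) Ht Hz; apply is_dt_iff; intros e He.
destruct (D t Ht e He) as (d & Hd & K).
exists d; split; [exact Hd|]; intros r Hr Hne Hrd.
eapply Rle_lt_trans; [|apply (K r Hr Hne Hrd)].
apply (CkM0_norm_ge M (fun z => (f r z - f t z) / (r - t) - dtM T f t z) z); [|exact Hz].
split; [intros [|j] x Hj; [exact I|lia]|].
intros x; assert (A1 := proj2 (C r Hr) x); assert (A2 := proj2 (C t Ht) x).
assert (A3 := proj2 (C' t Ht) x); simpl in *; unfold along in *.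
apply continuous_Rminus; [apply continuous_Rmult|exact A3].
- now apply continuous_Rminus.
- apply continuous_const.
Qed.

Lemma C0_in_time_pointwise (M : closed_curve) (T : R) (f : R -> R * R -> R) (t : R) (z : R * R) :
  C0_in_time M T 0 f -> 0 <= t <= T -> on_curve M z ->
  forall e, 0 < e -> exists d, 0 < d /\
    forall r, 0 <= r <= T -> Rabs (r - t) < d -> Rabs (f r z - f t z) < e.
Proof.
intros (C & D) Ht Hz e He; destruct (D t Ht e He) as (d & Hd & K).
exists d; split; [exact Hd|]; intros r Hr Hrd.
eapply Rle_lt_trans; [|apply (K r Hr Hrd)].
apply (CkM0_norm_ge M (fun z => f r z - f t z) z); [|exact Hz].
split; [intros [|j] x Hj; [exact I|lia]|].
intros x; assert (A1 := proj2 (C r Hr) x); assert (A2 := proj2 (C t Ht) x).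
simpl in *; unfold along in *; now apply continuous_Rminus.
Qed.

Lemma holder_pointwise (M : closed_curve) (T Rh : R) (f : R -> R * R -> R) (z : R * R)
    (tau t : R) :
  C1_in_time M T 0 f -> holder_estimate M T Rh f -> on_curve M z ->
  0 < tau <= T -> 0 <= t <= tau ->
  Rabs (dtM T f t z - dtM T f 0 z) <= Rh * Rpower tau (1 / 4).
Proof.
intros (_ & (C & _) & _) H Hz Htau Ht.
assert (B := H tau Htau t Ht).
assert (P := CkM_norm_nonneg M 2 (fun z => f t z - f 0 z)).
eapply Rle_trans; [|apply B].
enough (Rabs (dtM T f t z - dtM T f 0 z) <=
  CkM_norm M 0 (fun z => dtM T f t z - dtM T f 0 z)) by lra.
apply (CkM0_norm_ge M (fun z => dtM T f t z - dtM T f 0 z) z); [|exact Hz].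
split; [intros [|j] x Hj; [exact I|lia]|].
intros x; assert (A1 := proj2 (C t ltac:(lra)) x); assert (A2 := proj2 (C 0 ltac:(lra)) x).
simpl in *; unfold along in *; now apply continuous_Rminus.
Qed.

(** * The geometric evolution system *)

(** The points of the evolving curve move along the fixed line through [F z] in
    direction [nu z], so a coordinate is an affine function of the height. *)
Lemma is_dt_affine (T : R) (f : R -> R) (t l a b : R) :
  is_dt T f t l -> is_dt T (fun r => a + f r * b) t (l * b).
Proof.
rewrite !is_dt_iff; intros H e He.
assert (Hb : 0 < Rabs b + 1) by (assert (X := Rabs_pos b); lra).
destruct (H (e / (Rabs b + 1))) as (d & Hd & K); [now apply Rdiv_lt_0_compat|].
exists d; split; [exact Hd|]; intros r Hr Hne Hrd; specialize (K r Hr Hne Hrd).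
replace ((a + f r * b - (a + f t * b)) / (r - t) - l * b)
  with (((f r - f t) / (r - t) - l) * b) by (field; lra).
rewrite Rabs_mult.
assert (e / (Rabs b + 1) * (Rabs b + 1) = e) by (field; lra).
assert (X := Rabs_pos b); assert (Y := Rabs_pos ((f r - f t) / (r - t) - l)). nra.
Qed.

(** The velocity is [dt rho] times the reference normal, and a is the inverse of the
    cosine of the angle between the two normals; so the normal velocity is
    [g(c) H], and the tangential part of the velocity produces exactly the
    gradient term that distinguishes the two forms of the second equation. *)
Lemma solution_solves_geometric (G : R -> R) (M : closed_curve) (F nu : R * R -> R * R)
    (u0 rho0 : R * R -> R) (T : R) (rho u : R -> R * R -> R) :
  0 < T -> is_solution G M F nu u0 rho0 T rho u ->
  solves_geometric_system G M F nu T rho u.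
Proof.
intros HT (C & _ & _ & _ & _ & Imm & Eq) t s Ht; cbv zeta.
destruct (Eq t s Ht) as [E1 E2]; cbv zeta in E1, E2.
destruct (Imm t Ht s) as [_ Hpos].
assert (Hz : on_curve M (gam M s)) by now exists s.
assert (D := C1_in_time_is_dt M T rho t (gam M s) C Ht Hz).
assert (V1 : dt T (fun r => fst (theta F nu (rho r) (gam M s))) t =
  dtM T rho t (gam M s) * fst (nu (gam M s)))
  by exact (dt_unique _ _ _ _ HT Ht (is_dt_affine _ _ _ _ (fst (F (gam M s))) _ D)).
assert (V2 : dt T (fun r => snd (theta F nu (rho r) (gam M s))) t =
  dtM T rho t (gam M s) * snd (nu (gam M s)))
  by exact (dt_unique _ _ _ _ HT Ht (is_dt_affine _ _ _ _ (snd (F (gam M s))) _ D)).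
rewrite V1, V2.
assert (Dot : forall v, dot (dtM T rho t (gam M s) * fst (nu (gam M s)),
   dtM T rho t (gam M s) * snd (nu (gam M s))) v = dtM T rho t (gam M s) * dot (along M nu s) v)
  by (intros v; unfold dot, along; simpl; ring).
rewrite !Dot.
assert (V : dtM T rho t (gam M s) * dot (along M nu s) (nu_G M F nu (rho t) s) =
  g_of G (u t (gam M s)) * curvature M F nu (rho t) s).
{ rewrite E1; unfold a_factor, along at 1; field; lra. }
split; [exact V|]; rewrite V, E2, E1.
change (fun x : R => Derive G (along M (u t) x)) with (fun x : R => Derive G (u t (gam M x))).
change (along M (u t) s) with (u t (gam M s)); ring.
Qed.

(** * Curvature and velocity at the initial time *)

Lemma scal_pair (k : R) (v : R * R) : scal k v = (k * fst v, k * snd v).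
Proof. reflexivity. Qed.

(** Near [s0] the offset curve is the image of the reference curve under the
    homothety of factor [lam = 1 + sig e / Rad] about the centre, so tangents and
    normals are unchanged and the normal turns at the rate of a circle of radius
    [Rad + sig e]. *)
Lemma curvature_of_offset_circle (M : closed_curve) (F nu : R * R -> R * R)
    (Rad sig e s0 d : R) :
  0 < Rad -> sig * sig = 1 -> 0 < e < Rad -> 0 < d ->
  vCk 1 (along M F) -> (forall s, dvec (along M F) s <> (0, 0)) ->
  (forall s, dot (along M nu s) (along M nu s) = 1) ->
  (forall s, dot (along M nu s) (dvec (along M F) s) = 0) ->
  (forall s, Rabs (s - s0) < d ->
     centred Rad (along M F) s =
       (sig * Rad * vfst (along M nu) s, sig * Rad * vsnd (along M nu) s)) ->
  curvature M F nu (fun _ => e) s0 = - sig / (Rad + sig * e) /\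
  a_factor M F nu (fun _ => e) s0 = 1.
Proof.
intros HR Hs He Hd [C1 C2] Hreg Hu Hn Hc; rewrite Ck1_iff in C1, C2.
set (f := along M F) in *; set (n := along M nu) in *.
set (q := along M (theta F nu (fun _ => e))).
set (lam := 1 + e * (sig / Rad)).
assert (Hsg : sig = 1 \/ sig = -1) by (destruct (Rle_dec 0 sig); [left|right]; nra).
assert (Hlam : 0 < lam).
{ unfold lam; replace (1 + e * (sig / Rad)) with ((Rad + sig * e) / Rad) by (field; lra).
  apply Rdiv_lt_0_compat; [|lra]; destruct Hsg as [-> | ->]; lra. }
assert (En : forall s, Rabs (s - s0) < d ->
  vfst n s = sig / Rad * (vfst f s - Rad) /\ vsnd n s = sig / Rad * vsnd f s).
{ intros s Hsd; assert (E := Hc s Hsd); unfold centred in E; injection E; intros E2 E1.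
  rewrite E1, E2; split.
  - transitivity (sig * sig * vfst n s); [rewrite Hs; ring|field; lra].
  - transitivity (sig * sig * vsnd n s); [rewrite Hs; ring|field; lra]. }
assert (Loc : forall s, Rabs (s - s0) < d -> locally s (fun y => Rabs (y - s0) < d)).
{ intros s Hsd.
  apply (filter_imp (fun y => s0 - d < y /\ y < s0 + d)).
  - intros y Hy; apply Rabs_def1; lra.
  - apply Rabs_def2 in Hsd; apply filter_and;
      [apply (open_gt (s0 - d)); lra|apply (open_lt (s0 + d)); lra]. }
assert (Aff : forall (h g : R -> R) (a b s : R), Rabs (s - s0) < d ->
  (forall x, ex_derive g x) ->
  (forall y, Rabs (y - s0) < d -> h y = a * g y + b) -> Derive h s = a * Derive g s).
{ intros h g a b s Hsd Hg Eh.
  transitivity (Derive (fun y => a * g y + b) s).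
  - apply Derive_ext_loc; apply (filter_imp (fun y => Rabs (y - s0) < d)); [exact Eh|].
    now apply Loc.
  - rewrite Derive_plus, Derive_scal, Derive_const; [ring| |apply ex_derive_const].
    apply ex_derive_scal, Hg. }
assert (Dn : forall s, Rabs (s - s0) < d ->
  dvec n s = (sig / Rad * fst (dvec f s), sig / Rad * snd (dvec f s))).
{ intros s Hsd; unfold dvec; cbn [fst snd]; f_equal.
  - apply (Aff _ _ _ (- (sig / Rad * Rad))); [exact Hsd|apply C1|].
    intros y Hy; rewrite (proj1 (En y Hy)); ring.
  - apply (Aff _ _ _ 0); [exact Hsd|apply C2|].
    intros y Hy; rewrite (proj2 (En y Hy)); ring. }
assert (Dq : forall s, Rabs (s - s0) < d ->
  dvec q s = (lam * fst (dvec f s), lam * snd (dvec f s))).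
{ intros s Hsd; unfold dvec; cbn [fst snd]; f_equal.
  - apply (Aff _ _ _ (- (e * (sig / Rad) * Rad))); [exact Hsd|apply C1|].
    intros y Hy; transitivity (vfst f y + e * vfst n y); [reflexivity|].
    rewrite (proj1 (En y Hy)); unfold lam; ring.
  - apply (Aff _ _ _ 0); [exact Hsd|apply C2|].
    intros y Hy; transitivity (vsnd f y + e * vsnd n y); [reflexivity|].
    rewrite (proj2 (En y Hy)); unfold lam; ring. }
assert (Ut : forall s, Rabs (s - s0) < d -> utangent q s = utangent f s).
{ intros s Hsd; unfold utangent; rewrite (Dq s Hsd).
  assert (P := nonzero_dot _ (Hreg s)).
  assert (V : vnorm (lam * fst (dvec f s), lam * snd (dvec f s)) = lam * vnorm (dvec f s)).
  { unfold vnorm, dot; cbn [fst snd].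
    transitivity (sqrt (lam * lam * (fst (dvec f s) * fst (dvec f s)
      + snd (dvec f s) * snd (dvec f s)))); [f_equal; ring|].
    rewrite sqrt_mult, sqrt_square by nra; reflexivity. }
  rewrite V.
  assert (Hv : 0 < vnorm (dvec f s)) by (apply sqrt_lt_R0; exact P).
  destruct (dvec f s) as [a b]; cbn [fst snd] in *.
  rewrite !scal_pair; cbn [fst snd]; f_equal; field; lra. }
assert (Nn : forall s, Rabs (s - s0) < d -> nu_G M F nu (fun _ => e) s = n s).
{ intros s Hsd; unfold nu_G; fold f n q; rewrite (Ut s Hsd); unfold utangent.
  assert (P := nonzero_dot _ (Hreg s)); assert (N := Hn s); assert (U := Hu s).
  assert (Hv : 0 < vnorm (dvec f s)) by (apply sqrt_lt_R0; exact P).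
  assert (Hv2 : vnorm (dvec f s) * vnorm (dvec f s) = dot (dvec f s) (dvec f s))
    by (apply sqrt_sqrt; unfold dot; lra).
  revert P N U Hv Hv2; generalize (vnorm (dvec f s)); intros v.
  destruct (dvec f s) as [a b], (n s) as [n1 n2]; unfold dot; cbn [fst snd].
  intros P N U Hv Hv2.
  rewrite !scal_pair; unfold rot; cbn [fst snd]; f_equal.
  - apply (Rmult_eq_reg_r (v * v)); [|nra].
    transitivity (n1 * (b * b) - n2 * a * b); [field; lra|]; rewrite Hv2.
    transitivity (n1 * (a * a + b * b) - (n1 * a + n2 * b) * a); [ring|rewrite N; ring].
  - apply (Rmult_eq_reg_r (v * v)); [|nra].
    transitivity (n2 * (a * a) - n1 * a * b); [field; lra|]; rewrite Hv2.
    transitivity (n2 * (a * a + b * b) - (n1 * a + n2 * b) * b); [ring|rewrite N; ring]. }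
assert (H0 : Rabs (s0 - s0) < d) by (rewrite Rminus_diag, Rabs_R0; exact Hd).
split.
- unfold curvature, sdiv; fold q.
  assert (Dg : dvec (nu_G M F nu (fun _ => e)) s0 = dvec n s0).
  { unfold dvec; f_equal; apply Derive_ext_loc;
      apply (filter_imp (fun y => Rabs (y - s0) < d)); try (now apply Loc);
      intros y Hy; unfold vfst, vsnd; now rewrite Nn. }
  rewrite Dg, (Dn s0 H0), (Dq s0 H0).
  assert (P := nonzero_dot _ (Hreg s0)).
  destruct (dvec f s0) as [a b]; unfold dot; cbn [fst snd] in *.
  assert (El : lam * Rad = Rad + sig * e) by (unfold lam; field; lra).
  assert (Hq : 0 < lam * a * (lam * a) + lam * b * (lam * b)).
  { replace (lam * a * (lam * a) + lam * b * (lam * b))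
      with (lam * lam * (a * a + b * b)) by ring.
    repeat apply Rmult_lt_0_compat; assumption. }
  rewrite <- El; field; repeat split; lra.
- unfold a_factor; rewrite (Nn s0 H0); fold n; rewrite Hu; field.
Qed.

Lemma curvature_ext (M : closed_curve) (F nu : R * R -> R * R) (rho rho' : R * R -> R)
    (s : R) : (forall x, rho (gam M x) = rho' (gam M x)) ->
  curvature M F nu rho s = curvature M F nu rho' s /\
  a_factor M F nu rho s = a_factor M F nu rho' s.
Proof.
intros H.
assert (E : along M (theta F nu rho) = along M (theta F nu rho'))
  by (apply functional_extensionality; intros x; unfold along, theta; now rewrite H).
unfold curvature, a_factor, nu_G; now rewrite E.
Qed.

(** The endpoints of the arc differ from the origin, so that z_l and z_r are interior
    points of I_l and I_r and have circular neighbourhoods. *)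
Lemma polar_end_not_origin (Rad a : R) :
  0 < Rad -> - (2 * PI) < a < 2 * PI -> polar_pt Rad a Rad = (0, 0) -> a = 0.
Proof.
intros HR Ha E; injection E; intros _ E1.
assert (C : cos a = 1) by (apply (Rmult_eq_reg_l Rad); lra).
replace a with (2 * (a / 2)) in C by field; rewrite cos_2a_sin in C.
assert (S0 : sin (a / 2) = 0) by nra.
apply sin_zero_small in S0; lra.
Qed.

Lemma initial_geometry_l (M : closed_curve) (F nu : R * R -> R * R) (Rad : R)
    (S : reference_curve M F nu Rad) (z : R * R) (e : R) :
  I_l S z -> F z = (0, 0) -> 0 < e < Rad ->
  exists s, z = gam M s /\ curvature M F nu (fun _ => e) s = - 1 / (Rad + e) /\
    a_factor M F nu (fun _ => e) s = 1.
Proof.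
intros (s & Hs & ->) E He; exists s; split; [reflexivity|].
assert (HR := Rad_pos _ _ _ _ S).
destruct (arc_contains_origin _ _ _ _ S) as [A1 A2]; assert (A3 := arc_proper _ _ _ _ S).
destruct (Jp_closes _ _ _ _ S) as [Cp _]; destruct (Jm_closes _ _ _ _ S) as [_ Cm].
assert (s <> b0 _ _ _ _ S).
{ intros ->; rewrite <- (gam_shift M _ 1), Rmult_1_l, Cm in E.
  apply polar_end_not_origin in E; lra. }
assert (s <> b1 _ _ _ _ S).
{ intros ->; rewrite Cp in E; apply polar_end_not_origin in E; lra. }
destruct (curvature_of_offset_circle M F nu Rad 1 e s
  (Rmin (s - b0 _ _ _ _ S) (b1 _ _ _ _ S - s))) as [H1 H2]; trivial.
- ring.
- apply Rmin_glb_lt; lra.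
- apply (reference_C1 S).
- apply (F_immersion _ _ _ _ S).
- apply (nu_unit _ _ _ _ S).
- apply (nu_normal _ _ _ _ S).
- intros x Hx; apply (normal_on_Il S); apply Rabs_def2 in Hx.
  assert (X1 := Rmin_l (s - b0 _ _ _ _ S) (b1 _ _ _ _ S - s)).
  assert (X2 := Rmin_r (s - b0 _ _ _ _ S) (b1 _ _ _ _ S - s)); lra.
- split; [rewrite H1; f_equal; ring|exact H2].
Qed.

Lemma initial_geometry_r (M : closed_curve) (F nu : R * R -> R * R) (Rad : R)
    (S : reference_curve M F nu Rad) (z : R * R) (e : R) :
  I_r S z -> F z = (0, 0) -> 0 < e < Rad ->
  exists s, z = gam M s /\ curvature M F nu (fun _ => e) s = 1 / (Rad - e) /\
    a_factor M F nu (fun _ => e) s = 1.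
Proof.
intros (s & Hs & ->) E He; exists s; split; [reflexivity|].
assert (HR := Rad_pos _ _ _ _ S).
destruct (arc_contains_origin _ _ _ _ S) as [A1 A2]; assert (A3 := arc_proper _ _ _ _ S).
destruct (Jp_closes _ _ _ _ S) as [_ Cp]; destruct (Jm_closes _ _ _ _ S) as [Cm _].
assert (s <> b2 _ _ _ _ S).
{ intros ->; rewrite Cp in E; apply polar_end_not_origin in E; lra. }
assert (s <> b3 _ _ _ _ S).
{ intros ->; rewrite Cm in E; apply polar_end_not_origin in E; lra. }
destruct (curvature_of_offset_circle M F nu Rad (-1) e s
  (Rmin (s - b2 _ _ _ _ S) (b3 _ _ _ _ S - s))) as [H1 H2]; trivial.
- ring.
- apply Rmin_glb_lt; lra.
- apply (reference_C1 S).
- apply (F_immersion _ _ _ _ S).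
- apply (nu_unit _ _ _ _ S).
- apply (nu_normal _ _ _ _ S).
- intros x Hx; apply (normal_on_Ir S); apply Rabs_def2 in Hx.
  assert (X1 := Rmin_l (s - b2 _ _ _ _ S) (b3 _ _ _ _ S - s)).
  assert (X2 := Rmin_r (s - b2 _ _ _ _ S) (b3 _ _ _ _ S - s)); lra.
- split; [rewrite H1; replace (Rad + -1 * e) with (Rad - e) by ring; f_equal; ring|exact H2].
Qed.

Lemma initial_velocity (G : R -> R) (M : closed_curve) (F nu : R * R -> R * R)
    (u0 : R * R -> R) (e T : R) (rho u : R -> R * R -> R) (s : R) :
  0 < T -> is_solution G M F nu u0 (fun _ => e) T rho u ->
  a_factor M F nu (fun _ => e) s = 1 ->
  dtM T rho 0 (gam M s) = g_of G (u0 (gam M s)) * curvature M F nu (fun _ => e) s.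
Proof.
intros HT (_ & _ & _ & _ & Init & _ & Eq) Ha.
destruct (Eq 0 s ltac:(lra)) as [-> _].
destruct (curvature_ext M F nu (rho 0) (fun _ => e) s) as [-> ->].
{ intros x; apply Init; now exists x. }
unfold along; rewrite (proj2 (Init (gam M s) ltac:(now exists s))), Ha; ring.
Qed.

(** * The crossing of the strands *)

(** Mean value and intermediate value theorem on [0, tau]. The function is
    first extended by constants, since nothing is known about it outside this
    interval. *)
Lemma crossing_time (f df : R -> R) (tau k : R) :
  0 < tau -> 
  (forall t, 0 <= t <= tau -> forall e, 0 < e -> exists d, 0 < d /\
     forall r, 0 <= r <= tau -> Rabs (r - t) < d -> Rabs (f r - f t) < e) ->
  (forall t, 0 <= t <= tau -> is_dt tau f t (df t)) ->
  (forall t, 0 <= t <= tau -> df t <= - k) ->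
  0 < f 0 < k * tau -> exists t, 0 < t <= tau /\ f t = 0.
Proof.
intros Htau Hc Hd Hk H0.
set (cl := fun x => Rmax 0 (Rmin x tau)).
assert (Cl : forall x, 0 <= cl x <= tau).
{ intros x; unfold cl; split; [apply Rmax_l|apply Rmax_lub; [lra|apply Rmin_r]]. }
assert (Cin : forall x, 0 <= x <= tau -> cl x = x)
  by (intros x Hx; unfold cl; rewrite Rmin_left, Rmax_right; lra).
assert (Lip : forall x y, Rabs (cl x - cl y) <= Rabs (x - y)).
{ intros x y; unfold cl, Rmax, Rmin, Rabs.
  destruct (Rle_dec x tau), (Rle_dec y tau); repeat destruct Rle_dec;
    repeat destruct Rcase_abs; lra. }
assert (Cont : forall x, continuity_pt (fun y => f (cl y)) x).
{ intros x e He; destruct (Hc (cl x) (Cl x) e He) as (d & Hd' & K).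
  exists d; split; [exact Hd'|]; intros y [_ Hy]; simpl in *; unfold R_dist in *.
  apply K; [apply Cl|]; eapply Rle_lt_trans; [apply Lip|exact Hy]. }
assert (Der : forall x, 0 < x < tau -> is_derive (fun y => f (cl y)) x (df x)).
{ intros x Hx; apply (is_derive_ext_loc f).
  - apply (filter_imp (fun y => 0 < y /\ y < tau)).
    + intros y Hy; rewrite Cin by lra; reflexivity.
    + apply filter_and; [now apply (open_gt 0)|now apply (open_lt tau)].
  - apply is_derive_Reals; intros e He.
    destruct (proj1 (is_dt_iff _ _ _ _) (Hd x ltac:(lra)) e He) as (d & Hd' & K).
    assert (Hm : 0 < Rmin d (Rmin x (tau - x))) by (repeat apply Rmin_glb_lt; lra).
    exists (mkposreal _ Hm); intros h Hh0 Hh; simpl in Hh.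
    assert (X1 := Rmin_l d (Rmin x (tau - x))); assert (X2 := Rmin_r d (Rmin x (tau - x))).
    assert (X3 := Rmin_l x (tau - x)); assert (X4 := Rmin_r x (tau - x)).
    specialize (K (x + h)); replace (x + h - x) with h in K by ring.
    apply K; [apply Rabs_def2 in Hh; lra|lra|lra]. }
destruct (MVT_gen (fun y => f (cl y)) 0 tau (fun x => df (cl x))) as (c & Hc' & E).
{ rewrite Rmin_left, Rmax_right by lra; intros x Hx; rewrite Cin by lra; now apply Der. }
{ intros x _; apply Cont. }
rewrite !Cin in E by lra.
assert (Dk := Hk (cl c) (Cl c)).
assert (Ht : f tau < 0) by nra.
destruct (IVT_gen (fun y => f (cl y)) 0 tau 0 Cont) as (t & Ht1 & Ht2).
{ rewrite !Cin by lra; rewrite Rmin_right, Rmax_left; lra. }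
rewrite Rmin_left, Rmax_right in Ht1 by lra; rewrite Cin in Ht2 by lra.
exists t; split; [|exact Ht2].
destruct (Req_dec t 0) as [->|]; lra.
Qed.

(** The initial rate of change of the width is [- (gl - gr) / Rad] in the limit
    [e -> 0]; half of that rate survives for small [e]. *)
Lemma strands_approach (gl gr Rad e : R) :
  0 < Rad -> 0 < gr < gl -> 0 < e -> e < (gl - gr) * Rad / (2 * (gl + gr)) ->
  gl * (- 1 / (Rad + e)) + gr * (1 / (Rad - e)) <= - ((gl - gr) / (2 * Rad)).
Proof.
intros HR Hg He Hb.
assert (B : e * (2 * (gl + gr)) < (gl - gr) * Rad).
{ apply (Rmult_lt_compat_r (2 * (gl + gr))) in Hb; [|lra].
  replace ((gl - gr) * Rad / (2 * (gl + gr)) * (2 * (gl + gr)))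
    with ((gl - gr) * Rad) in Hb by (field; lra). exact Hb. }
assert (HeR : e < Rad) by nra.
apply Rminus_le.
replace (_ - _) with
  ((2 * Rad * ((gl + gr) * e) - (gl - gr) * (Rad * Rad) - (gl - gr) * (e * e))
    * / (2 * Rad * (Rad + e) * (Rad - e))) by (field; lra).
assert (0 < / (2 * Rad * (Rad + e) * (Rad - e)))
  by (apply Rinv_0_lt_compat; repeat apply Rmult_lt_0_compat; lra).
assert (2 * Rad * ((gl + gr) * e) - (gl - gr) * (Rad * Rad) - (gl - gr) * (e * e) <= 0).
{ assert (e * (2 * (gl + gr)) * Rad <= (gl - gr) * Rad * Rad)
    by (apply Rmult_le_compat_r; lra).
  assert (0 <= (gl - gr) * (e * e)) by (apply Rmult_le_pos; nra). lra. }
nra.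
Qed.

Lemma small_time (T Rh k : R) : 0 < T -> 0 < Rh -> 0 < k ->
  exists tau, 0 < tau <= T /\ Rh * Rpower tau (1 / 4) <= k.
Proof.
intros HT HRh Hk.
assert (Hx : 0 < k / Rh) by now apply Rdiv_lt_0_compat.
assert (Hp : 0 < Rpower (k / Rh) 4) by apply exp_pos.
exists (Rmin T (Rpower (k / Rh) 4)); split.
- split; [now apply Rmin_glb_lt|apply Rmin_l].
- apply Rle_trans with (Rh * Rpower (Rpower (k / Rh) 4) (1 / 4)).
  + apply Rmult_le_compat_l; [lra|]; apply Rle_Rpower_l; [lra|].
    split; [now apply Rmin_glb_lt|apply Rmin_r].
  + rewrite Rpower_mult; replace (4 * (1 / 4)) with 1 by field.
    rewrite Rpower_1 by exact Hx; apply Req_le; field; lra.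
Qed.

(** As [nu zl] and [nu zr] are opposite and both points start at the origin, their
    images coincide as soon as [rho t zl + rho t zr] vanishes. *)
Lemma self_intersection (G : R -> R) (M : closed_curve) (F nu : R * R -> R * R) (Rad : R)
  (S : reference_curve M F nu Rad) (zl zr : R * R) (u0 : R * R -> R) (T Rh : R) :
  (forall x, 0 < g_of G x) -> I_l S zl -> I_r S zr -> zl <> zr ->
  F zl = (0, 0) -> F zr = (0, 0) -> nu zl = (-1, 0) -> nu zr = (1, 0) ->
  g_of G (u0 zl) > g_of G (u0 zr) -> 0 < T -> 0 < Rh ->
  exists e0, 0 < e0 /\ forall e rho u, 0 < e < e0 ->
    is_evolution G M F nu u0 (fun _ => e) T Rh rho u ->
    exists t, 0 < t <= T /\ ~ inj_on (theta F nu (rho t)) (on_curve M).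
Proof.
intros Hg Hzl Hzr Hne Fl Fr Nl Nr Hgt HT HRh.
assert (HR := Rad_pos _ _ _ _ S).
assert (gr_pos := Hg (u0 zr)).
set (gl := g_of G (u0 zl)) in *; set (gr := g_of G (u0 zr)) in *.
set (k := (gl - gr) / (2 * Rad)).
assert (Hk : 0 < k) by (apply Rdiv_lt_0_compat; lra).
destruct (small_time T Rh (k / 4) HT HRh ltac:(lra)) as (tau & Htau & Hsmall).
(* The first two bounds make the width decrease at rate k initially, the last one
   makes the initial width 2 e smaller than its loss k / 2 * tau up to tau. *)
exists (Rmin Rad (Rmin ((gl - gr) * Rad / (2 * (gl + gr))) (k / 4 * tau))); split.
{ repeat apply Rmin_glb_lt; [exact HR| |nra].
  apply Rdiv_lt_0_compat; nra. }
intros e rho u He [Sol [Hol _]].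
assert (X1 := Rmin_l Rad (Rmin ((gl - gr) * Rad / (2 * (gl + gr))) (k / 4 * tau))).
assert (X2 := Rmin_r Rad (Rmin ((gl - gr) * Rad / (2 * (gl + gr))) (k / 4 * tau))).
assert (X3 := Rmin_l ((gl - gr) * Rad / (2 * (gl + gr))) (k / 4 * tau)).
assert (X4 := Rmin_r ((gl - gr) * Rad / (2 * (gl + gr))) (k / 4 * tau)).
destruct (initial_geometry_l M F nu Rad S zl e Hzl Fl ltac:(lra)) as (sl & El & Hl & Al).
destruct (initial_geometry_r M F nu Rad S zr e Hzr Fr ltac:(lra)) as (sr & Er & Hr & Ar).
assert (Vl := initial_velocity _ _ _ _ _ _ _ _ _ _ HT Sol Al).
assert (Vr := initial_velocity _ _ _ _ _ _ _ _ _ _ HT Sol Ar).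
rewrite <- El, Hl in Vl; rewrite <- Er, Hr in Vr; fold gl in Vl; fold gr in Vr.
assert (Ol : on_curve M zl) by (rewrite El; now exists sl).
assert (Or : on_curve M zr) by (rewrite Er; now exists sr).
destruct Sol as (C1 & _ & _ & _ & Init & _).
assert (Slow := strands_approach gl gr Rad e HR ltac:(lra) ltac:(lra) ltac:(lra)).
destruct (crossing_time (fun t => rho t zl + rho t zr)
  (fun t => dtM T rho t zl + dtM T rho t zr) tau (k / 2)) as (t & Ht & E).
- lra.
- intros t Ht d Hd.
  destruct (C0_in_time_pointwise M T rho t zl (proj1 C1) ltac:(lra) Ol (d / 2) ltac:(lra))
    as (d1 & Hd1 & K1).
  destruct (C0_in_time_pointwise M T rho t zr (proj1 C1) ltac:(lra) Or (d / 2) ltac:(lra))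
    as (d2 & Hd2 & K2).
  exists (Rmin d1 d2); split; [now apply Rmin_glb_lt|]; intros r Hr' Hrd.
  assert (Y1 := Rmin_l d1 d2); assert (Y2 := Rmin_r d1 d2).
  specialize (K1 r ltac:(lra) ltac:(lra)); specialize (K2 r ltac:(lra) ltac:(lra)).
  apply Rabs_def2 in K1; apply Rabs_def2 in K2; apply Rabs_def1; lra.
- intros t Ht.
  assert (Dl := C1_in_time_is_dt M T rho t zl C1 ltac:(lra) Ol).
  assert (Dr := C1_in_time_is_dt M T rho t zr C1 ltac:(lra) Or).
  rewrite is_dt_iff in Dl, Dr |- *; intros d Hd.
  destruct (Dl (d / 2) ltac:(lra)) as (d1 & Hd1 & K1).
  destruct (Dr (d / 2) ltac:(lra)) as (d2 & Hd2 & K2).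
  exists (Rmin d1 d2); split; [now apply Rmin_glb_lt|]; intros r Hr' Hrt Hrd.
  assert (Y1 := Rmin_l d1 d2); assert (Y2 := Rmin_r d1 d2).
  specialize (K1 r ltac:(lra) Hrt ltac:(lra)); specialize (K2 r ltac:(lra) Hrt ltac:(lra)).
  replace ((rho r zl + rho r zr - (rho t zl + rho t zr)) / (r - t)) with
    ((rho r zl - rho t zl) / (r - t) + (rho r zr - rho t zr) / (r - t)) by (field; lra).
  apply Rabs_def2 in K1; apply Rabs_def2 in K2; apply Rabs_def1; lra.
- intros t Ht.
  assert (Bl := holder_pointwise M T Rh rho zl tau t C1 Hol Ol Htau Ht).
  assert (Br := holder_pointwise M T Rh rho zr tau t C1 Hol Or Htau Ht).
  apply Rabs_le_between in Bl; apply Rabs_le_between in Br.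
  rewrite Vl in Bl; rewrite Vr in Br; fold k in Slow; lra.
- rewrite (proj1 (Init zl Ol)), (proj1 (Init zr Or)); lra.
(* The images are (- rho t zl, 0) and (rho t zr, 0). *)
- exists t; split; [lra|]; intros Inj; apply Hne, Inj; trivial.
  unfold theta; rewrite Fl, Fr, Nl, Nr, !scal_pair; cbn [fst snd].
  unfold plus; simpl; unfold prod_plus, plus; simpl; f_equal; lra.
Qed.

Theorem theorem3p12 (G : R -> R)
  (G_C7 : Ck 7 G)
  (G_convex : forall x : R, 0 < Derive_n G 2 x)
  (g_pos : forall x : R, 0 < g_of G x)
  (g_not_constant : ~ exists k : R, forall x : R, g_of G x = k)
  (M : closed_curve) (F nu : R * R -> R * R) (Rad : R)
  (S : reference_curve M F nu Rad)
  (zl zr : R * R) (zl_in : I_l S zl) (zr_in : I_r S zr) (zl_neq_zr : zl <> zr)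
  (F_zl : F zl = (0, 0)) (F_zr : F zr = (0, 0))
  (nu_zl : nu zl = (-1, 0)) (nu_zr : nu zr = (1, 0))
  (rho0 : R) (rho0_pos : 0 < rho0)
  (u0 : R * R -> R) (u0_C4 : CkM M 4 u0)
  (g_u0 : g_of G (u0 zl) > g_of G (u0 zr)) :
  (exists eps0 : R, 0 < eps0 /\ forall eps : R, 0 < eps < eps0 ->
     is_embedding M (theta F nu (fun _ => eps * rho0))) /\
  (forall delta1 delta0 T Rh : R, 0 < delta1 ->
     short_time_existence G M F nu u0 delta1 delta0 T Rh ->
     exists eps0 : R, 0 < eps0 /\ forall eps : R, 0 < eps < eps0 ->
       (exists rho u : R -> R * R -> R,
          is_evolution G M F nu u0 (fun _ => eps * rho0) T Rh rho u) /\
       (forall rho u : R -> R * R -> R,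
          is_evolution G M F nu u0 (fun _ => eps * rho0) T Rh rho u ->
          solves_geometric_system G M F nu T rho u /\
          exists t : R, 0 < t <= T /\ ~ inj_on (theta F nu (rho t)) (on_curve M))).
Proof.
assert (Scale : forall d eps, 0 < eps < d / rho0 -> 0 < eps * rho0 < d).
{ intros d eps H; split; [nra|]; replace d with (d / rho0 * rho0) by (field; lra); nra. }
split.
- destruct (offset_embedding S) as (d & Hd & P).
  exists (d / rho0); split; [now apply Rdiv_lt_0_compat|]; intros eps He; apply P; auto.
- intros delta1 delta0 T Rh Hd1 (Hd0 & HT & HRh & Exist).
  destruct (self_intersection G M F nu Rad S zl zr u0 T Rh) as (e0 & He0 & Cross); trivial.
  set (d := Rmin e0 (Rmin delta1 delta0)).
  assert (Hd : 0 < d) by (unfold d; repeat apply Rmin_glb_lt; assumption).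
  assert (d <= e0 /\ d <= delta1 /\ d <= delta0).
  { assert (X1 := Rmin_l e0 (Rmin delta1 delta0)); assert (X2 := Rmin_r e0 (Rmin delta1 delta0)).
    assert (X3 := Rmin_l delta1 delta0); assert (X4 := Rmin_r delta1 delta0).
    unfold d; lra. }
  exists (d / rho0); split; [now apply Rdiv_lt_0_compat|]; intros eps He.
  apply Scale in He.
  split.
  + apply Exist; [apply CkM_const| |]; rewrite CkM_norm_const, Rabs_pos_eq; lra.
  + intros rho u Ev; split.
    * exact (solution_solves_geometric _ _ _ _ _ _ _ _ _ HT (proj1 Ev)).
    * apply (Cross (eps * rho0) rho u); [lra|exact Ev].
Qed.
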